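(* Let $R$ be a field of characteristic $0$, $r\ge2$, $n\ge3$, and let $\Lambda=\Lambda_{j_1}+\dots+\Lambda_{j_r}$ be a dominant weight with $|j_a-j_b|>2$ for $a\ne b$. Let $\lambda\in\mathfrak B_n^{(r)}-\mathfrak D_n^{(r)}$ be a one-column $r$-partition of $n$ whose non-empty components are the $u$-th and $v$-th ($u<v$), let $\Lambda'=\Lambda_{j_u}+\Lambda_{j_v}$ and $\lambda'=(\lambda^{(u)},\lambda^{(v)})$. Let $L(\lambda)$ and $L(\lambda')$ be the simple modules of $TL_{r,1,n}^\Lambda$ and $TLB_n^{\Lambda'}$ corresponding to $\lambda$ and $\lambda'$. Then $\dim(L(\lambda))=\dim(L(\lambda'))$.
   Context: Weights. $q\in R^*$, $q\neq1$; $e$ is the smallest positive integer with $1+q+\dots+q^{e-1}=0$, and $e=0$ if none exists; $I=\mathbb{Z}/e\mathbb{Z}$. For $a,b\in I$, $|a-b|:=\min\{|c-d| : c,d\in\mathbb{Z},\ c\equiv a,\ d\equiv b \bmod e\}$. The $\Lambda_i$ are fundamental weights and $\alpha_i$ simple roots ($i\in I$), with $(\Lambda_i,\alpha_j)=\delta_{ij}$. The hypotheses on $\Lambda$ force $e=0$ or $e\ge 6$. Write $i\to j$ (also $j\leftarrow i$) if $j=i+1$. KLR algebra. $\mathfrak S_n$ acts on $I^n$ by place permutation, $s_k$ swapping entries $k,k+1$. For each $\mathfrak S_n$-orbit $O\subseteq I^n$ let $\mathcal R_O^\Lambda$ be the unital associative $R$-algebra with generators $\psi_1,\dots,\psi_{n-1},y_1,\dots,y_n,e(\mathbf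 i)$ ($\mathbf i=(i_1,\dots,i_n)\in O$) and relations: $y_1^{(\Lambda,\alpha_{i_1})}e(\mathbf i)=0$; $e(\mathbf i)e(\mathbf j)=\delta_{\mathbf i\mathbf j}e(\mathbf i)$; $\sum_{\mathbf i\in O} e(\mathbf i)=1$; $e(\mathbf i)y_k=y_ke(\mathbf i)$; $\psi_ke(\mathbf i)=e(s_k\mathbf i)\psi_k$; $y_ky_l=y_ly_k$; $\psi_ky_l=y_l\psi_k$ if $l\ne k,k+1$; $\psi_k\psi_l=\psi_l\psi_k$ if $|k-l|\ne1$; $\psi_ky_{k+1}e(\mathbf i)=(y_k\psi_k+\delta_{i_k,i_{k+1}})e(\mathbf i)$; $y_{k+1}\psi_ke(\mathbf i)=(\psi_ky_k+\delta_{i_k,i_{k+1}})e(\mathbf i)$; $\psi_k^2e(\mathbf i)$ equals $0$ if $i_k=i_{k+1}$, $(y_{k+1}-y_k)e(\mathbf i)$ if $i_k\to i_{k+1}$, $(y_k-y_{k+1})e(\mathbf i)$ if $i_k\leftarrow i_{k+1}$, and $e(\mathbf i)$ otherwise; $(\psi_k\psi_{k+1}\psi_k-\psi_{k+1}\psi_k\psi_{k+1})e(\mathbf i)$ equals $e(\mathbf i)$ if $i_{k+2}=i_k\to i_{k+1}$, $-e(\mathbf i)$ if $i_{k+2}=i_k\leftarrow i_{k+1}$, and $0$ otherwise. Put $\mathcal R_n^\Lambda=\bigoplus_O\mathcal R_O^\Lambda$ (only finitely many summands are nonzero); $\psi_k,y_k$ also denote the sums of the corresponding elements over all $O$. $*$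 is the $R$-linear anti-automorphism fixing all generators. Temperley-Lieb quotients. $\mathcal J_n=\mathcal J_n(\Lambda)$ is the two-sided ideal of $\mathcal R_n^\Lambda$ generated by all $e(\mathbf i)$ with $(\alpha_{i_1},\Lambda)>0$ and $i_2=i_1+1$, and all $e(\mathbf i)$ with $i_1,i_2,i_3$ pairwise distinct and $(\alpha_{i_a},\Lambda)>0$ for $a=1,2,3$. $TL_{r,1,n}^\Lambda=\mathcal R_n^\Lambda/\mathcal J_n(\Lambda)$, and $TLB_n^{\Lambda'}=\mathcal R_n^{\Lambda'}/\mathcal J_n(\Lambda')$ is the same construction for $\Lambda'$ (with $r=2$). Combinatorics. A one-column $r$-partition $\lambda=(\lambda^{(1)},\dots,\lambda^{(r)})$ of $n$ is an $r$-tuple of one-column partitions of total size $n$, identified with its set of nodes $[\lambda]=\{(a,1,l):1\le l\le r,\ 1\le a\le|\lambda^{(l)}|\}$. $\mathfrak B_n^{(r)}$ is the set of these and $\mathfrak D_n^{(r)}$ the subset of those with at least three non-empty components. Nodes are totally ordered by $(a,1,l)<(a',1,l')$ iff $a<a'$, or $a=a'$ and $l<l'$. $\lambda\unlhd\mu$ iff for every node $\gamma_0\in\mathbb N\times\{1\}\times\{1,\dots,r\}$, $|\{\gamma\in[\lambda]:\gamma\le\gamma_0\}|\ge|\{\gamma\in[\mu]:\gamma\le\gamma_0\}|$. A tableau of shape $\lambda$ is a bijection $t:\{1,\dots,n\}\to[\lambda]$; it is standard if the numbers increase down each column; $Std(\lambda)$ is the set of standard ones. $t^\lambda$ is the tableau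 with $t^\lambda(1)<\dots<t^\lambda(n)$; $d(t)\in\mathfrak S_n$ is defined by $t=t^\lambda\circ d(t)$. The residue of $(a,1,l)$ is $1-a+j_l\in I$; $e_\lambda=e(\mathbf i)$ where $i_k$ is the residue of $t^\lambda(k)$. For the bipartition $\lambda'$ the residues are computed with $(j_u,j_v)$ in place of $(j_1,\dots,j_r)$. Cell and simple modules. For each $t\in Std(\lambda)$ fix a reduced expression $d(t)=s_{i_1}\cdots s_{i_k}$ and put $\psi_{d(t)}=\psi_{i_1}\cdots\psi_{i_k}$; the family is chosen ''official'': deleting the last letter of the word for $d(t)\ne1$ gives the chosen word for $d(s)$ for some $s\in Std(\lambda)$. The images of $C_{s,t}^\lambda=\psi_{d(s)}^*e_\lambda\psi_{d(t)}$, $\lambda\in\mathfrak B_n^{(r)}-\mathfrak D_n^{(r)}$, $s,t\in Std(\lambda)$, form a cellular basis of $TL_{r,1,n}^\Lambda$ with respect to $\unlhd$. $W(\lambda)$ is the left module with basis $\{C_s:s\in Std(\lambda)\}$ and $aC_s=\sum_{s'}r_a(s',s)C_{s'}$, where $aC_{s,t}^\lambda\equiv\sum_{s'}r_a(s',s)C_{s',t}^\lambda$ modulo the span of the $C^\mu_{x,y}$ with $\mu\triangleleft\lambda$. The bilinear form $\phi_\lambda$ on $W(\lambda)$ is defined by $C^\lambda_{s',t}C^\lambda_{s,t'}\equiv\phi_\lambda(C_t,C_s)C^\lambda_{s',t'}$ modulo the same span, and $L(\lambda)=W(\lambda)/\mathrm{rad}(\phi_\lambda)$. The same definitions with $(2,\Lambda',\lambda')$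 in place of $(r,\Lambda,\lambda)$ give $L(\lambda')$. *)

(* Defs.v *)
From HB Require Import structures.
From mathcomp Require Import all_boot all_order all_algebra.
From mathcomp Require Import perm generic_quotient ring_quotient.
From mathcomp Require Import finmap boolp.
From mathcomp.multinomials Require Import monalg.

Set Implicit Arguments.
Unset Strict Implicit.
Unset Printing Implicit Defensive.

Import GRing.Theory Num.Theory.
Local Open Scope ring_scope.
Local Open Scope quotient_scope.

(* An R-algebra is a ring with a ring morphism from R to its centre. MathComp's
   [algType] is not used because it requires [1 != 0], whereas most of the
   algebras attached to an orbit below are zero. *)
HB.mixin Record isPzAlgebra (R : pzRingType) A of GRing.PzRing A := {
  scalar : R -> A;
  scalarD : {morph scalar : a b / a + b};
  scalarM : {morph scalar : a b / a * b};
  scalar1 : scalar 1 = 1;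
  scalarC : forall (c : R) (x : A), scalar c * x = x * scalar c
}.

#[short(type="pzAlgType")]
HB.structure Definition PzAlgebra (R : pzRingType) :=
  {A of GRing.PzRing A & isPzAlgebra R A}.

Section QuotientAlgebra.
Variables (R : pzRingType) (A : pzAlgType R) (S : A -> Prop).

(* The two-sided ideal generated by S. Opposites and scalar multiples are
   obtained by multiplying by -1 and by [scalar c]. *)
Inductive ideal_gen : A -> Prop :=
| ideal_gen_base x : S x -> ideal_gen x
| ideal_gen0 : ideal_gen 0
| ideal_genD x y : ideal_gen x -> ideal_gen y -> ideal_gen (x + y)
| ideal_genMl a x : ideal_gen x -> ideal_gen (a * x)
| ideal_genMr a x : ideal_gen x -> ideal_gen (x * a).

Definition ideal_pred : A -> bool := fun x => `[< ideal_gen x >].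

Lemma ideal_predP x : reflect (ideal_gen x) (x \in ideal_pred).
Proof. exact: asboolP. Qed.

Lemma ideal_pred_zmod : zmod_closed ideal_pred.
Proof.
split; first by apply/ideal_predP; exact: ideal_gen0.
move=> x y /ideal_predP hx /ideal_predP hy; apply/ideal_predP.
by rewrite -mulN1r; apply: ideal_genD => //; apply: ideal_genMl.
Qed.

HB.instance Definition _ := GRing.isZmodClosed.Build A ideal_pred ideal_pred_zmod.

Definition ideal_closed : zmodClosed A := GRing.ZmodClosed.clone A ideal_pred _.

Definition quot_alg := Quotient.quot ideal_closed.

HB.instance Definition _ := GRing.Zmodule.on quot_alg.
HB.instance Definition _ := EqQuotient.on quot_alg.

Lemma quot_algE (x y : A) :
  (\pi_quot_alg x = \pi_quot_alg y) <-> ideal_gen (x - y).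
Proof.
split=> [/eqP|h]; first by rewrite -Quotient.idealrBE => /ideal_predP.
by apply/eqP; rewrite -Quotient.idealrBE; apply/ideal_predP.
Qed.

Definition quot_one : quot_alg := \pi_quot_alg 1.
Definition quot_mul (x y : quot_alg) : quot_alg := \pi_quot_alg (repr x * repr y).
Definition quot_scalar (c : R) : quot_alg := \pi_quot_alg (scalar c).

Lemma quot_repr (x : A) : ideal_gen (repr (\pi_quot_alg x) - x).
Proof. by apply/quot_algE; rewrite reprK. Qed.

Lemma quot_mulE x y :
  quot_mul (\pi_quot_alg x) (\pi_quot_alg y) = \pi_quot_alg (x * y).
Proof.
apply/quot_algE.
set x' := repr _; set y' := repr _.
have -> : x' * y' - x * y = (x' - x) * y' + x * (y' - y).
  by rewrite mulrBl mulrBr addrA subrK.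
by apply: ideal_genD; [apply: ideal_genMr|apply: ideal_genMl]; exact: quot_repr.
Qed.

Lemma quot_addE x y :
  \pi_quot_alg x + \pi_quot_alg y = \pi_quot_alg (x + y) :> quot_alg.
Proof. by rewrite piE. Qed.

Lemma quot_mulA : associative quot_mul.
Proof.
elim/quotW=> x; elim/quotW=> y; elim/quotW=> z.
by rewrite (quot_mulE y z) (quot_mulE x y) (quot_mulE x) (quot_mulE _ z) mulrA.
Qed.
Lemma quot_mul1 : left_id quot_one quot_mul.
Proof. by elim/quotW=> x; rewrite (quot_mulE 1 x) mul1r. Qed.
Lemma quot_1mul : right_id quot_one quot_mul.
Proof. by elim/quotW=> x; rewrite (quot_mulE x 1) mulr1. Qed.
Lemma quot_mulDl : left_distributive quot_mul +%R.
Proof.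
elim/quotW=> x; elim/quotW=> y; elim/quotW=> z.
by rewrite (quot_addE x y) (quot_mulE _ z) (quot_mulE x z) (quot_mulE y z)
  quot_addE mulrDl.
Qed.
Lemma quot_mulDr : right_distributive quot_mul +%R.
Proof.
elim/quotW=> x; elim/quotW=> y; elim/quotW=> z.
by rewrite (quot_addE y z) (quot_mulE x) (quot_mulE x y) (quot_mulE x z)
  quot_addE mulrDr.
Qed.

HB.instance Definition _ := GRing.Zmodule_isPzRing.Build quot_alg
  quot_mulA quot_mul1 quot_1mul quot_mulDl quot_mulDr.

Lemma quot_piM (x y : A) :
  \pi_quot_alg (x * y) = \pi_quot_alg x * \pi_quot_alg y :> quot_alg.
Proof. exact: esym (quot_mulE x y). Qed.

Lemma quot_scalarD : {morph quot_scalar : a b / a + b}.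
Proof. by move=> a b; rewrite /quot_scalar scalarD quot_addE. Qed.
Lemma quot_scalarM : {morph quot_scalar : a b / a * b}.
Proof. by move=> a b; rewrite /quot_scalar scalarM quot_piM. Qed.
Lemma quot_scalar1 : quot_scalar 1 = 1.
Proof. by rewrite /quot_scalar scalar1. Qed.
Lemma quot_scalarC c (x : quot_alg) : quot_scalar c * x = x * quot_scalar c.
Proof.
by elim/quotW: x => x; rewrite /quot_scalar -(quot_piM _ x) -(quot_piM x) scalarC.
Qed.

HB.instance Definition _ := isPzAlgebra.Build R quot_alg
  quot_scalarD quot_scalarM quot_scalar1 quot_scalarC.

End QuotientAlgebra.

Section ProductAlgebra.
Variables (R : pzRingType) (T : Type) (A : T -> pzAlgType R).

Definition prod_alg := forall t : T, A t.

HB.instance Definition _ := Choice.on prod_alg.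

Implicit Types x y z : prod_alg.

Definition prod_zero : prod_alg := fun=> 0.
Definition prod_opp x : prod_alg := fun t => - x t.
Definition prod_add x y : prod_alg := fun t => x t + y t.
Definition prod_one : prod_alg := fun=> 1.
Definition prod_mul x y : prod_alg := fun t => x t * y t.
Definition prod_scalar (c : R) : prod_alg := fun=> scalar c.

Lemma prod_addA : associative prod_add.
Proof. by move=> x y z; apply: functional_extensionality_dep => t; exact: addrA. Qed.
Lemma prod_addC : commutative prod_add.
Proof. by move=> x y; apply: functional_extensionality_dep => t; exact: addrC. Qed.
Lemma prod_add0 : left_id prod_zero prod_add.
Proof. by move=> x; apply: functional_extensionality_dep => t; exact: add0r. Qed.
Lemma prod_addN : left_inverse prod_zero prod_opp prod_add.
Proof. by move=> x; apply: functional_extensionality_dep => t; exact: addNr. Qed.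

HB.instance Definition _ := GRing.isZmodule.Build prod_alg
  prod_addA prod_addC prod_add0 prod_addN.

Lemma prod_mulA : associative prod_mul.
Proof. by move=> x y z; apply: functional_extensionality_dep => t; exact: mulrA. Qed.
Lemma prod_mul1 : left_id prod_one prod_mul.
Proof. by move=> x; apply: functional_extensionality_dep => t; exact: mul1r. Qed.
Lemma prod_1mul : right_id prod_one prod_mul.
Proof. by move=> x; apply: functional_extensionality_dep => t; exact: mulr1. Qed.
Lemma prod_mulDl : left_distributive prod_mul +%R.
Proof. by move=> x y z; apply: functional_extensionality_dep => t; exact: mulrDl. Qed.
Lemma prod_mulDr : right_distributive prod_mul +%R.
Proof. by move=> x y z; apply: functional_extensionality_dep => t; exact: mulrDr. Qed.

HB.instance Definition _ := GRing.Zmodule_isPzRing.Build prod_alg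
  prod_mulA prod_mul1 prod_1mul prod_mulDl prod_mulDr.

Lemma prod_scalarD : {morph prod_scalar : a b / a + b}.
Proof. by move=> a b; apply: functional_extensionality_dep => t; exact: scalarD. Qed.
Lemma prod_scalarM : {morph prod_scalar : a b / a * b}.
Proof. by move=> a b; apply: functional_extensionality_dep => t; exact: scalarM. Qed.
Lemma prod_scalar1 : prod_scalar 1 = 1.
Proof. by apply: functional_extensionality_dep => t; exact: scalar1. Qed.
Lemma prod_scalarC c x : prod_scalar c * x = x * prod_scalar c.
Proof. by apply: functional_extensionality_dep => t; exact: scalarC. Qed.

HB.instance Definition _ := isPzAlgebra.Build R prod_alg
  prod_scalarD prod_scalarM prod_scalar1 prod_scalarC.

End ProductAlgebra.

(* Noncommutative polynomials: {fmonom X} is the free monoid of words over X. *)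
Definition free_alg (R : comNzRingType) (X : choiceType) := {malg R[{fmonom X}]}.

Definition free_gen (R : comNzRingType) (X : choiceType) (x : X) : free_alg R X :=
  << fmu x >>.

Section FreeAlgebra.
Variables (R : comNzRingType) (X : choiceType).

HB.instance Definition _ := GRing.Lalgebra.on (free_alg R X).

Definition free_scalar (c : R) : free_alg R X := c%:A.

Lemma free_scalarD : {morph free_scalar : a b / a + b}.
Proof. by move=> a b; exact: scalerDl. Qed.
Lemma free_scalarM : {morph free_scalar : a b / a * b}.
Proof. by move=> a b; rewrite /free_scalar -scalerAl mul1r scalerA. Qed.
Lemma free_scalar1 : free_scalar 1 = 1.
Proof. exact: scale1r. Qed.
Lemma free_scalarC c (x : free_alg R X) : free_scalar c * x = x * free_scalar c.
Proof.
have cE : c%:A = c%:MP :> {malg R[{fmonom X}]}.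
  by rewrite -mul_malgC mulr1.
rewrite /free_scalar -[_ *: 1]/(c%:A : {malg R[{fmonom X}]}) cE.
rewrite !malgM_def fgmulUg fgmulgU.
by apply: eq_bigr => k _; rewrite mulrC mul1m mulm1.
Qed.

HB.instance Definition _ := isPzAlgebra.Build R (free_alg R X)
  free_scalarD free_scalarM free_scalar1 free_scalarC.

End FreeAlgebra.

Section QuotientSpace.
Import VectorInternalTheory.
Variables (K : fieldType) (V : vectType K) (U : {vspace V}).

Definition quot_space := Quotient.quot (GRing.ZmodClosed.clone V (pred_of_vspace U) _).

HB.instance Definition _ := GRing.Zmodule.on quot_space.
HB.instance Definition _ := EqQuotient.on quot_space.

Definition qs_scale (c : K) (x : quot_space) : quot_space :=
  \pi_quot_space (c *: repr x).

Lemma qs_piE (x y : V) :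
  (\pi_quot_space x = \pi_quot_space y) <-> (x - y \in U).
Proof.
split=> [/eqP|h]; first by rewrite -Quotient.idealrBE.
by apply/eqP; rewrite -Quotient.idealrBE.
Qed.

Lemma qs_repr (x : V) : repr (\pi_quot_space x) - x \in U.
Proof. by apply/qs_piE; rewrite reprK. Qed.

Lemma qs_scaleE c x : qs_scale c (\pi_quot_space x) = \pi_quot_space (c *: x).
Proof. by apply/qs_piE; rewrite -scalerBr memvZ // qs_repr. Qed.

Lemma qs_addE x y :
  \pi_quot_space x + \pi_quot_space y = \pi_quot_space (x + y) :> quot_space.
Proof. by rewrite piE. Qed.

Lemma qs_scaleA a b v : qs_scale a (qs_scale b v) = qs_scale (a * b) v.
Proof.
by elim/quotW: v => v; rewrite (qs_scaleE b v) (qs_scaleE a) (qs_scaleE _ v) scalerA.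
Qed.
Lemma qs_scale1 : left_id 1 qs_scale.
Proof. by elim/quotW=> v; rewrite (qs_scaleE 1 v) scale1r. Qed.
Lemma qs_scaleDr : right_distributive qs_scale +%R.
Proof.
move=> c; elim/quotW=> x; elim/quotW=> y.
by rewrite (qs_addE x y) (qs_scaleE c) (qs_scaleE c x) (qs_scaleE c y) qs_addE
  scalerDr.
Qed.
Lemma qs_scaleDl v : {morph qs_scale^~ v : a b / a + b}.
Proof.
move=> a b /=; elim/quotW: v => v.
by rewrite (qs_scaleE _ v) (qs_scaleE a v) (qs_scaleE b v) qs_addE scalerDl.
Qed.

HB.instance Definition _ := GRing.Zmodule_isLmodule.Build K quot_space
  qs_scaleA qs_scale1 qs_scaleDr qs_scaleDl.

Lemma qs_piZ c x : c *: \pi_quot_space x = \pi_quot_space (c *: x) :> quot_space.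
Proof. exact: qs_scaleE. Qed.

(* Coordinates on V / U are those of the complement U^C of U in V. *)
Let coC (x : V) : subvs_of (U^C)%VS := vsproj (U^C)%VS (x - projv U x).

Let coC_val x : vsval (coC x) = x - projv U x.
Proof. by rewrite vsprojK // memv_projC. Qed.

Let coC_linear : linear coC.
Proof.
move=> c x y; apply: val_inj; rewrite linearP /= !coC_val linearP.
by rewrite scalerBr opprD addrACA.
Qed.

Let coC_U x y : x - y \in U -> coC x = coC y.
Proof.
move=> xyU; apply: val_inj; rewrite /= !coC_val.
apply/eqP; rewrite -subr_eq0.
have -> : x - projv U x - (y - projv U y) = (x - y) - projv U (x - y).
  rewrite (linearB (projv U)) /= !opprB addrACA [RHS]addrACA.
  by congr (_ + _); rewrite addrC.
by rewrite projv_id // subrr.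
Qed.

Lemma qs_vect_subdef : Vector.axiom (dim (subvs_of (U^C)%VS)) quot_space.
Proof.
exists (fun x : quot_space => v2r (coC (repr x))).
  move=> c; elim/quotW=> x; elim/quotW=> y.
  rewrite qs_piZ qs_addE -linearP -coC_linear; congr (v2r _).
  rewrite (coC_U (qs_repr _)); rewrite !coC_linear.
  by rewrite (coC_U (qs_repr x)) (coC_U (qs_repr y)).
exists (fun r => \pi_quot_space (vsval (r2v r))) => [|r].
  elim/quotW=> x; rewrite v2rK coC_val; apply/qs_piE.
  rewrite addrAC rpredB ?memv_proj //; exact: qs_repr.
rewrite (coC_U (qs_repr _)) -[RHS]r2vK; congr v2r.
apply: val_inj; rewrite /= coC_val; set w := vsval _.
suff -> : projv U w = 0 by rewrite subr0.
have wC : w \in (U^C)%VS by exact: subvsP.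
by apply/eqP; rewrite -memv_ker lker_proj.
Qed.

HB.instance Definition _ := Lmodule_hasFinDim.Build K quot_space qs_vect_subdef.

End QuotientSpace.

Definition quantum_char (R : fieldType) (q : R) (e : nat) : Prop :=
  [/\ (0 < e)%N, \sum_(i < e) q ^+ i = 0
    & forall m : nat, (0 < m < e)%N -> \sum_(i < m) q ^+ i != 0]
  \/ e = 0%N /\ forall m : nat, (0 < m)%N -> \sum_(i < m) q ^+ i != 0.

(* Z/eZ, as the set of canonical remainders mod e. For e = 0 the remainder
   (c %% 0)%Z is c itself, so that [residue 0] is Z. *)
Definition residue (e : nat) := {c : int | (c %% e)%Z == c}.

Lemma to_residue_subproof (e : nat) (c : int) : ((c %% e)%Z %% e)%Z == (c %% e)%Z.
Proof. by rewrite modz_mod. Qed.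

Definition to_residue (e : nat) (c : int) : residue e :=
  exist _ (c %% e)%Z (to_residue_subproof e c).

Definition res_succ (e : nat) (a : residue e) : residue e := to_residue e (val a + 1).

Definition is_res_dist (e : nat) (a b : residue e) (m : nat) : Prop :=
  exists c d : int,
    [/\ (c = val a %[mod e])%Z, (d = val b %[mod e])%Z & m = `|c - d|%N].

Lemma res_dist_subproof (e : nat) (a b : residue e) :
  exists m : nat, `[< is_res_dist a b m >].
Proof.
by exists `|val a - val b|%N; apply/asboolP; exists (val a), (val b).
Qed.

Definition res_dist (e : nat) (a b : residue e) : nat := ex_minn (res_dist_subproof a b).

(* A dominant weight Lambda is given by its coefficients i |-> (Lambda, alpha_i). *)
Definition weight (e : nat) := residue e -> nat.

Definition fundamental_weight (e : nat) (i : residue e) : weight e := fun k => (i == k).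

Definition weight_of (e r : nat) (j : 'I_r -> residue e) : weight e :=
  fun k => (\sum_(a < r) fundamental_weight (j a) k)%N.

Section Positions.
Variable n : nat.

(* k : 'I_n.-1 stands for the index k + 1 of psi, and [pos k], [pos' k] for the
   positions k + 1 and k + 2 among 1, ..., n. *)
Lemma pos'_subproof (k : 'I_n.-1) : (k.+1 < n)%N.
Proof. by case: n k => [|m] [k hk]. Qed.

Definition pos (k : 'I_n.-1) : 'I_n := widen_ord (leq_pred n) k.
Definition pos' (k : 'I_n.-1) : 'I_n := Ordinal (pos'_subproof k).

Definition transp (k : 'I_n.-1) : 'S_n := tperm (pos k) (pos' k).

Definition res_seq (e : nat) := {ffun 'I_n -> residue e}.

Definition place (e : nat) (s : 'S_n) (i : res_seq e) : res_seq e := [ffun x => i (s x)].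

Definition orbit_of (e : nat) (i : res_seq e) : {fset res_seq e} :=
  [fset place s i | s in 'S_n]%fset.

Definition block (e : nat) := {O : {fset res_seq e} | exists i, O = orbit_of i}.

End Positions.

Section KLR.
Variables (R : fieldType) (e n : nat) (Lam : weight e).

Section Block.
Variable O : {fset res_seq n e}.

Definition klr_gen : choiceType := ('I_n.-1 + 'I_n + O)%type.
Definition klr_free := free_alg R klr_gen.

Definition fpsi (k : 'I_n.-1) : klr_free := free_gen R (inl (inl k) : klr_gen).
Definition fy (k : 'I_n) : klr_free := free_gen R (inl (inr k) : klr_gen).
Definition fe (i : O) : klr_free := free_gen R (inr i : klr_gen).

Inductive klr_rel : klr_free -> klr_free -> Prop :=
| klr_cyclotomic (k : 'I_n) (i : O) : k = 0%N :> nat ->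
    klr_rel (fy k ^+ Lam (val i k) * fe i) 0
| klr_idem (i i' : O) : klr_rel (fe i * fe i') (if i == i' then fe i else 0)
| klr_sum1 : klr_rel (\sum_(i : O) fe i) 1
| klr_ey (i : O) (k : 'I_n) : klr_rel (fe i * fy k) (fy k * fe i)
| klr_psie (i i' : O) (k : 'I_n.-1) : val i' = place (transp k) (val i) ->
    klr_rel (fpsi k * fe i) (fe i' * fpsi k)
| klr_yy (k l : 'I_n) : klr_rel (fy k * fy l) (fy l * fy k)
| klr_psiy (k : 'I_n.-1) (l : 'I_n) : l != pos k -> l != pos' k ->
    klr_rel (fpsi k * fy l) (fy l * fpsi k)
| klr_psipsi (k l : 'I_n.-1) : k.+1 != l :> nat -> l.+1 != k :> nat ->
    klr_rel (fpsi k * fpsi l) (fpsi l * fpsi k)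
| klr_psiyR (k : 'I_n.-1) (i : O) :
    klr_rel (fpsi k * fy (pos' k) * fe i)
            ((fy (pos k) * fpsi k + (val i (pos k) == val i (pos' k))%:R) * fe i)
| klr_yRpsi (k : 'I_n.-1) (i : O) :
    klr_rel (fy (pos' k) * fpsi k * fe i)
            ((fpsi k * fy (pos k) + (val i (pos k) == val i (pos' k))%:R) * fe i)
| klr_psi2 (k : 'I_n.-1) (i : O) (a := val i (pos k)) (b := val i (pos' k)) :
    klr_rel (fpsi k ^+ 2 * fe i)
            (if a == b then 0
             else if b == res_succ a then (fy (pos' k) - fy (pos k)) * fe i
             else if a == res_succ b then (fy (pos k) - fy (pos' k)) * fe i
             else fe i)
| klr_braid (k l : 'I_n.-1) (i : O)
    (a := val i (pos k)) (b := val i (pos' k)) (c := val i (pos' l)) :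
    k.+1 = l :> nat ->
    klr_rel ((fpsi k * fpsi l * fpsi k - fpsi l * fpsi k * fpsi l) * fe i)
            (if (c == a) && (b == res_succ a) then fe i
             else if (c == a) && (a == res_succ b) then - fe i
             else 0).

Definition klr_block := quot_alg (fun x => exists a b, klr_rel a b /\ x = a - b).

End Block.

(* The direct sum of the block algebras. Only finitely many of them are nonzero,
   so it is also their product, which is where the unit and the elements
   klr_psi k and klr_y k live. *)
Definition klr := prod_alg (fun O : block n e => klr_block (sval O)).

Definition klr_psi (k : 'I_n.-1) : klr := fun O => \pi_(klr_block (sval O)) (fpsi (sval O) k).
Definition klr_y (k : 'I_n) : klr := fun O => \pi_(klr_block (sval O)) (fy (sval O) k).
Definition klr_e (i : res_seq n e) : klr :=
  fun O => if insub i is Some i' then \pi_(klr_block (sval O)) (fe (i' : sval O)) else 0.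

(* The x's are the first positions 1, 2, 3. *)
Inductive TL_gen : klr -> Prop :=
| TL_gen2 (i : res_seq n e) (x1 x2 : 'I_n) :
    x1 = 0%N :> nat -> x2 = 1%N :> nat ->
    (0 < Lam (i x1))%N -> i x2 = res_succ (i x1) ->
    TL_gen (klr_e i)
| TL_gen3 (i : res_seq n e) (x1 x2 x3 : 'I_n) :
    x1 = 0%N :> nat -> x2 = 1%N :> nat -> x3 = 2%N :> nat ->
    i x1 != i x2 -> i x1 != i x3 -> i x2 != i x3 ->
    (0 < Lam (i x1))%N -> (0 < Lam (i x2))%N -> (0 < Lam (i x3))%N ->
    TL_gen (klr_e i).

Definition TL := quot_alg TL_gen.

Definition tl_psi (k : 'I_n.-1) : TL := \pi_TL (klr_psi k).
Definition tl_e (i : res_seq n e) : TL := \pi_TL (klr_e i).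

End KLR.

Section Combinatorics.
Variables (r n : nat).

(* A one-column r-partition of n is given by the sizes of its components. *)
Definition ocpart := {f : {ffun 'I_r -> 'I_n.+1} | (\sum_l f l == n)%N}.

Definition comp_size (lam : ocpart) (l : 'I_r) : nat := val lam l.

Definition notD (lam : ocpart) : bool := (#|[set l | 0 < comp_size lam l]| < 3)%N.

(* (a, l) stands for the node (a, 1, l); the row a is counted from 1. *)
Definition node := ('I_n.+1 * 'I_r)%type.

Definition node_le (g h : nat * 'I_r) : bool :=
  (g.1 < h.1)%N || (g.1 == h.1) && (g.2 <= h.2)%N.

Definition to_pair (g : node) : nat * 'I_r := (val g.1, g.2).

Definition nodes (lam : ocpart) : {set node} :=
  [set g : node | (0 < g.1 <= comp_size lam g.2)%N].

Definition dominated (lam mu : ocpart) : Prop :=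
  forall g0 : nat * 'I_r,
    (#|[set g in nodes mu | node_le (to_pair g) g0]|
       <= #|[set g in nodes lam | node_le (to_pair g) g0]|)%N.

Definition strictly_dominated (lam mu : ocpart) : Prop :=
  dominated lam mu /\ lam <> mu.

Definition is_std (lam : ocpart) (t : {ffun 'I_n -> node}) : bool :=
  [&& injectiveb t, t @: [set: 'I_n] == nodes lam &
    [forall k, forall m,
       ((t k).2 == (t m).2) && ((t k).1 < (t m).1)%N ==> (k < m)%N]].

Definition Std (lam : ocpart) := {t : {ffun 'I_n -> node} | is_std lam t}.

Lemma card_nodes (lam : ocpart) : #|nodes lam| = n.
Proof.
rewrite -sum1_card big_mkcond /=.
pose F (a : 'I_n.+1) (l : 'I_r) := nat_of_bool (0 < a <= comp_size lam l)%N.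
transitivity (\sum_g F g.1 g.2)%N.
  by apply: eq_bigr => g _; rewrite /F inE; case: ifP.
rewrite -(pair_bigA _ F) exchange_big /= -[RHS](eqP (valP lam)).
apply: eq_bigr => l _; rewrite -/(comp_size lam l) /F.
have: (comp_size lam l <= n)%N by rewrite -ltnS ltn_ord.
move: (comp_size lam l) => m lemn.
rewrite big_ord_recl /= add0n.
rewrite (eq_bigr (fun a : 'I_n => nat_of_bool (a < m)%N)); last by move=> a _.
rewrite -big_mkcond /= -(big_ord_widen _ (fun=> 1%N) lemn).
by rewrite sum1_card card_ord.
Qed.

Definition node_seq (lam : ocpart) : seq node :=
  sort (fun g h => node_le (to_pair g) (to_pair h)) (enum (nodes lam)).

Lemma size_node_seq (lam : ocpart) : size (node_seq lam) == n.
Proof. by rewrite size_sort -cardE card_nodes. Qed.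

(* t^lam lists the nodes of lam in increasing order. *)
Definition tab_init (lam : ocpart) : {ffun 'I_n -> node} :=
  [ffun k => tnth (Tuple (size_node_seq lam)) k].

(* The composite s_(k_1) o ... o s_(k_m) for w = [:: k_1; ...; k_m]. Products in
   'S_n compose from left to right, hence the [rev]. *)
Definition word_perm (w : seq 'I_n.-1) : 'S_n := (\prod_(k <- rev w) transp k)%g.

Definition reduced (w : seq 'I_n.-1) : Prop :=
  forall w' : seq 'I_n.-1, word_perm w' = word_perm w -> (size w <= size w')%N.

Definition d_spec (lam : ocpart) (t : Std lam) (d : 'S_n) : Prop :=
  forall k : 'I_n, val t k = tab_init lam (d k).

Definition word_family := forall lam : ocpart, Std lam -> seq 'I_n.-1.

Definition official (w : word_family) : Prop :=
  forall (lam : ocpart) (t : Std lam),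
    [/\ d_spec t (word_perm (w lam t)), reduced (w lam t)
      & word_perm (w lam t) != 1%g ->
        exists (s : Std lam) (k : 'I_n.-1), w lam t = rcons (w lam s) k].

End Combinatorics.

Section Cell.
Variables (R : fieldType) (e r n : nat) (j : 'I_r -> residue e).
Variable w : word_family r n.

Let Lam := weight_of j.
Let A := TL R n Lam.

Definition node_res (g : node r n) : residue e :=
  to_residue e (1 - (g.1 : nat)%:Z + val (j g.2)).

Definition tab_res (lam : ocpart r n) : res_seq n e :=
  [ffun k => node_res (tab_init lam k)].

Definition psi_word (u : seq 'I_n.-1) : A := \prod_(k <- u) tl_psi R Lam k.

(* The anti-involution * fixes the generators, so it sends psi_u to psi_(rev u). *)
Definition cellC (lam : ocpart r n) (s t : Std lam) : A :=
  psi_word (rev (w s)) * tl_e R Lam (tab_res lam) * psi_word (w t).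

Inductive lower_span (lam : ocpart r n) : A -> Prop :=
| lower_span0 : lower_span lam 0
| lower_spanD (c : R) (mu : ocpart r n) (x y : Std mu) (z : A) :
    notD mu -> strictly_dominated mu lam -> lower_span lam z ->
    lower_span lam (scalar c * cellC x y + z).

Definition congr_lower (lam : ocpart r n) (x y : A) : Prop := lower_span lam (x - y).

(* The cell module W(lam): its underlying space has basis (C_s), s in Std(lam);
   [cell_coef a s' s] is r_a(s', s) and [cell_gram t s] is phi_lam(C_t, C_s).
   Both families are determined by the stated congruences because the images of
   the [cellC] form a cellular basis of [TL]. *)
Record cell_module (lam : ocpart r n) := CellModule {
  cell_coef : A -> Std lam -> Std lam -> R;
  cell_gram : Std lam -> Std lam -> R;
  cell_coefP : forall (a : A) (s t : Std lam),
    congr_lower lam (a * cellC s t)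
      (\sum_(s' : Std lam) scalar (cell_coef a s' s) * cellC s' t);
  cell_gramP : forall s' t s t' : Std lam,
    congr_lower lam (cellC s' t * cellC s t')
      (scalar (cell_gram t s) * cellC s' t')
}.

Section Simple.
Variables (lam : ocpart r n) (W : cell_module lam).

Definition cell_space := {ffun Std lam -> R^o}.

Definition cell_act (a : A) (x : cell_space) : cell_space :=
  [ffun s' => \sum_(s : Std lam) cell_coef W a s' s * x s].

Definition cell_form (x y : cell_space) : R :=
  \sum_(t : Std lam) \sum_(s : Std lam) x t * y s * cell_gram W t s.

Definition to_dual (x : cell_space) : cell_space :=
  [ffun s => \sum_(t : Std lam) x t * cell_gram W t s].

Definition cell_rad : {vspace cell_space} := lker (linfun to_dual).

Lemma to_dual_linear : linear to_dual.
Proof.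
move=> c x y; apply/ffunP => s; rewrite !ffunE scaler_sumr -big_split /=.
by apply: eq_bigr => t _; rewrite !ffunE mulrDl scalerAl.
Qed.

HB.instance Definition _ :=
  GRing.isLinear.Build R cell_space cell_space _ to_dual to_dual_linear.

Lemma mem_cell_rad (x : cell_space) :
  x \in cell_rad <-> forall y : cell_space, cell_form x y = 0.
Proof.
have formE y : cell_form x y = \sum_s y s * to_dual x s.
  rewrite /cell_form exchange_big /=; apply: eq_bigr => s _.
  rewrite ffunE mulr_sumr; apply: eq_bigr => t _.
  by rewrite [x t * y s]mulrC mulrA.
rewrite memv_ker lfunE /=; split=> [/eqP x0 y | h].
  by rewrite formE big1 // => s _; rewrite x0 ffunE mulr0.
apply/eqP/ffunP => s; rewrite [RHS]ffunE.
have := h [ffun s' => (s' == s)%:R]; rewrite formE (bigD1 s) //= ffunE eqxx mul1r.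
by rewrite big1 ?addr0 // => s' /negPf ne; rewrite ffunE ne mul0r.
Qed.

Definition simple_module := quot_space cell_rad.

(* Well defined on W(lam) / rad(phi_lam), because phi_lam (a x, y) = phi_lam (x, a^* y). *)
Definition simple_act (a : A) (x : simple_module) : simple_module :=
  \pi_(simple_module) (cell_act a (repr x)).

End Simple.

End Cell.

Definition two_fun (T : Type) (a b : T) : 'I_2 -> T := fun l => if l == ord0 then a else b.

(* Main.v *)
Require Import Defs.
From HB Require Import structures.
From mathcomp Require Import all_boot all_order all_algebra.
From mathcomp Require Import generic_quotient perm finmap boolp.
From mathcomp.multinomials Require Import monalg.
From mathcomp Require Import zify ring.

Set Implicit Arguments.
Unset Strict Implicit.
Unset Printing Implicit Defensive.

Import Order.TTheory GRing.Theory Num.Theory.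
Local Open Scope ring_scope.
Local Open Scope quotient_scope.

(** Why the two dimensions agree.  Write e for e_lambda and take both outer
    tableaux in the defining congruence of the form to be t^lambda, whose
    official word is empty.  The Gram entry phi(C_t, C_s) is then a scalar g
    such that e psi_d(t) (psi_d(s))^star e is congruent to g e modulo the cells
    below lambda.  Hence g can be read off in any module that is killed by the
    cells below lambda but not by e.  One such module is built below for both
    algebras at once: it depends only on the charges j_u, j_v and on the lengths
    of the two columns.  So the two Gram matrices coincide under the evident
    bijection of standard tableaux, and so do the dimensions of the quotients by
    their radicals.

    The module.  A walk is a sequence of n choices between the columns u and v;
    it has a residue sequence.  Let z be an indeterminate.  On functions from
    walks to the fraction field of R[z], let y_k multiply by z or by 0 according
    to the k-th choice, let e(i) restrict to the walks with residues i, and let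
    psi_k act by the divided differences of the polynomial representation of
    Khovanov and Lauda.  This is that representation evaluated at the points
    where the strands of column u carry the value z and those of column v carry
    0.  All relations but the cyclotomic one hold exactly; the braid relation
    [psi_braid] is the longest check.  The R[z]-span L of the functions P(y) e(i),
    with P a polynomial in the y's, is stable under psi_k as well, because divided
    differences preserve polynomials ([lattice_psi]).  On L/zL the first dot y_1
    vanishes, which gives the cyclotomic relation ([annih_cyclotomic]).  Rather
    than forming L/zL, the proof uses the two-sided ideal [annih] of those
    noncommutative polynomials that map L into zL.

    This ideal contains the generators of the Temperley-Lieb ideal, because no
    walk starts with the residues they involve ([ann_klr_TL_gen]).  It contains
    e_mu for every mu strictly dominated by lambda: a walk of shape lambda that
    follows the residues of t^mu and leaves t^mu can only do so by stepping into
    the shorter of its two columns, after which lambda has more nodes in the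
    first rows than mu, against dominance ([match_shape]).  It does not contain e_lambda, since the
    function e_lambda takes the value 1 at the walk of t^lambda and 1 is not
    divisible by z ([idem_not_annih]).

    Two official families may choose different reduced words for the same d(t).
    A permutation that merges two increasing sequences avoids the pattern 321,
    and the reduced words of such a permutation differ only by exchanging
    distant letters, so psi_d(t) is the same for both ([reduced_prod_eq]). *)

(** * Evaluation of noncommutative polynomials *)

Section FreeLift.
Variables (R : comNzRingType) (X : choiceType) (S : nzRingType).
Variables (f : {rmorphism R -> S}) (g : X -> S).
Hypothesis fC : forall c s, GRing.comm (f c) s.

Definition word_val (m : {fmonom X}) : S := \prod_(x <- m) g x.

Lemma word_val_mmorphism : mmorphism word_val.
Proof.
split=> [m1 m2|]; first by rewrite /word_val fmM big_cat.
by rewrite /word_val fm1 big_nil.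
Qed.

HB.instance Definition _ :=
  isMultiplicative.Build {fmonom X} S word_val word_val_mmorphism.

Definition free_lift : free_alg R X -> S := mmap f word_val.

Lemma free_liftB : {morph free_lift : a b / a - b}.
Proof. exact: mmapB. Qed.
Lemma free_liftD : {morph free_lift : a b / a + b}.
Proof. exact: mmapD. Qed.
Lemma free_lift0 : free_lift 0 = 0.
Proof. exact: mmap0. Qed.
Lemma free_lift1 : free_lift 1 = 1.
Proof. exact: mmap1. Qed.
Lemma free_liftM : {morph free_lift : a b / a * b}.
Proof.
by case: (@commr_mmap_is_multiplicative {fmonom X} R S f word_val) => // ? ? ?; exact: fC.
Qed.
Lemma free_lift_gen x : free_lift (free_gen R x) = g x.
Proof. by rewrite /free_lift mmapU /= rmorph1 mul1r /word_val /= fmU big_seq1. Qed.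
Lemma free_lift_scalar c : free_lift (Defs.scalar c) = f c.
Proof. by rewrite /free_lift -[Defs.scalar c]/(c *: (1 : {malg R[{fmonom X}]})) mmapZ mmap1 mulr1. Qed.
End FreeLift.

(** * Residues modulo e *)

Section Residues.
Variable e : nat.
Implicit Types a b : residue e.

Lemma to_residue_eq (c d : int) :
  (to_residue e c == to_residue e d) = (c == d %[mod e])%Z.
Proof. by rewrite -val_eqE. Qed.

Lemma val_residueK a : to_residue e (val a) = a.
Proof. by apply: val_inj; exact: (eqP (valP a)). Qed.

Lemma res_succ_to (c : int) : res_succ (to_residue e c) = to_residue e (c + 1).
Proof. by apply: val_inj; rewrite /= modzDml. Qed.

Lemma res_succ_inj : injective (@res_succ e).
Proof.
move=> a b /eqP; rewrite -(val_residueK a) -(val_residueK b) !res_succ_to.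
by rewrite !to_residue_eq eqz_modDr => h; apply/eqP; rewrite to_residue_eq.
Qed.

Lemma res_dist_le a b (c d : int) :
  to_residue e c = a -> to_residue e d = b -> (res_dist a b <= `|c - d|)%N.
Proof.
move=> <- <-; rewrite /res_dist; case: ex_minnP => m _; apply.
apply/asboolP; exists c, d; split=> //=; by rewrite modz_mod.
Qed.

Lemma eqz_mod_ex (c d : int) : (c == d %[mod e])%Z -> exists q : int, c = d + q * e.
Proof.
move=> h; exists ((c %/ e)%Z - (d %/ e)%Z).
have h1 := divz_eq c e; have h2 := divz_eq d e; move: h1 h2; rewrite (eqP h).
move: (c %/ e)%Z (d %/ e)%Z => x y hc; lia.
Qed.

(** Two residues at distance at least 3 force e = 0 or e >= 6: otherwise some
    representatives of a and b differ by at most 2. *)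
Lemma dist2_period a b (m : nat) : (2 < res_dist a b)%N -> (0 < m < 6)%N ->
  (m%:Z != 0 %[mod e])%Z.
Proof.
move=> hd hm; apply/negP => /eqz_mod_ex [q]; rewrite add0r => hq.
have e_gt0 : (0 < e)%N by case: (posnP e) hq => // ->; rewrite mulr0; lia.
have q_gt0 : 0 < q.
  rewrite ltNge; apply/negP => q_le0.
  have : q * e%:Z <= 0 by apply: mulr_le0_ge0.
  by rewrite -hq; lia.
have hE : e%:Z <= q * e%:Z by rewrite ler_peMl // ; lia.
pose c := val a; pose d := val b.
have h (t : int) : (2 < `|c - (d + t * e%:Z)%R|)%N.
  apply: leq_trans hd _; apply: res_dist_le; first exact: val_residueK.
  by apply/eqP; rewrite -(val_residueK b) to_residue_eq addrC modzMDl.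
pose Q := divz (c - d) e; pose s := modz (c - d) e.
have e_neq0 : e%:Z != 0 by lia.
have sE : c - d = Q * e%:Z + s := divz_eq (c - d) e.
have s_ge0 : 0 <= s := modz_ge0 (c - d) e_neq0.
have s_lt : s < e%:Z by have := ltz_mod (c - d) e_neq0.
have := h (Q + 1); have := h Q.
have -> : c - (d + Q * e%:Z) = s by rewrite opprD addrA sE; ring.
have -> : c - (d + (Q + 1) * e%:Z) = s - e%:Z by rewrite opprD addrA sE; ring.
lia.
Qed.
End Residues.

(** * Transpositions, walks and their residues *)

Section Positions.
Variable n : nat.
Implicit Types k l : 'I_n.-1.

Lemma pos_neq k : pos k != pos' k.
Proof. by rewrite -val_eqE /= neq_ltn ltnSn. Qed.

Lemma transpL k : transp k (pos k) = pos' k.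
Proof. exact: tpermL. Qed.

Lemma transpR k : transp k (pos' k) = pos k.
Proof. exact: tpermR. Qed.

Lemma transpD k (x : 'I_n) : x != pos k -> x != pos' k -> transp k x = x.
Proof. by move=> h h'; rewrite /transp tpermD // eq_sym. Qed.

Lemma transpK k : involutive (transp k).
Proof. exact: tpermK. Qed.

Lemma ltn_transp k (x : 'I_n) (m : nat) : m != k.+1 ->
  (transp k x < m)%N = (x < m)%N.
Proof.
move=> hm; rewrite /transp; case: tpermP => [->|->|//] /=; lia.
Qed.

Lemma transp_comm k l : k.+1 != l :> nat -> l.+1 != k :> nat ->
  (transp k * transp l = transp l * transp k)%g.
Proof.
move=> kl lk; have [->//|nkl] := eqVneq k l.
have nkl' : k != l :> nat by [].
by rewrite conjgC {2}/transp tpermJ !transpD // -val_eqE /=; lia.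
Qed.
End Positions.

Section CountBefore.
Variables (n : nat) (T : eqType) (f : 'I_n -> T).
Implicit Types (c : T) (m : nat).

Definition count_before c m : nat := \sum_(l < n) ((l < m) && (f l == c)).

Lemma count_before0 c : count_before c 0 = 0%N.
Proof. by rewrite /count_before big1. Qed.

Lemma count_beforeS c (x : 'I_n) :
  count_before c x.+1 = (count_before c x + (f x == c))%N.
Proof.
rewrite /count_before (bigD1 x) //= [in RHS](bigD1 x) //= ltnSn ltnn add0n addnC.
congr (_ + _)%N; apply: eq_bigr => l; rewrite -val_eqE /= => h.
by rewrite ltnS leq_eqVlt (negPf h).
Qed.

Lemma count_before_mono c m m' : (m <= m')%N ->
  (count_before c m <= count_before c m')%N.
Proof.
move=> h; apply: leq_sum => l _; case: (f l == c); rewrite ?andbF // !andbT.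
by case: (ltnP l m) => // hl; rewrite (leq_trans hl h).
Qed.
End CountBefore.

Section Walks.
Variables (e n : nat) (J : bool -> residue e).

(** The value [true] stands for a node added to column u, [false] for column v. *)
Definition walk := {ffun 'I_n -> bool}.
Implicit Types (p : walk) (k l : 'I_n.-1) (b : bool).

Local Notation taken p := (count_before (fun_of_fin p)).

(** The residue of the node added at step k: its row is one more than the number
    of earlier steps into the same column. *)
Definition walk_res p : res_seq n e :=
  [ffun k => to_residue e (val (J (p k)) - (taken p (p k) k)%:Z)].

Definition swap k p : walk := [ffun x => p (transp k x)].

Lemma taken_total p (m : nat) : (m <= n)%N ->
  (taken p true m + taken p false m = m)%N.
Proof.
move=> mn; rewrite -big_split /=.
rewrite -[RHS](card_ord m) -sum1_card (big_ord_widen _ (fun=> 1%N) mn).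
rewrite [RHS]big_mkcond /=; apply: eq_bigr => l _.
by case: (l < m)%N; case: (p l).
Qed.

Lemma taken_swap k p b (m : nat) : m != k.+1 -> taken (swap k p) b m = taken p b m.
Proof.
move=> hm; rewrite /count_before (reindex_inj (inv_inj (transpK k))) /=.
by apply: eq_bigr => l _; rewrite ltn_transp // ffunE transpK.
Qed.

Lemma swapK k : involutive (swap k).
Proof. by move=> p; apply/ffunP => x; rewrite !ffunE transpK. Qed.

(** The two nodes lie in different columns, so exchanging them changes neither
    row. *)
Lemma walk_res_swap k p : p (pos k) != p (pos' k) ->
  walk_res (swap k p) = place (transp k) (walk_res p).
Proof.
move=> hp; apply/ffunP => x; rewrite !ffunE.
have [->|x1] := eqVneq x (pos k).
  rewrite transpL taken_swap /= ?neq_ltn ?ltnSn //.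
  by rewrite (count_beforeS p _ (pos k)) (negPf hp) addn0.
have [->|x2] := eqVneq x (pos' k).
  rewrite transpR /= (count_beforeS _ _ (pos k)) ffunE transpL eq_sym (negPf hp) addn0.
  by rewrite taken_swap //= neq_ltn ltnSn.
by rewrite transpD // taken_swap // -[k.+1]/(val (pos' k)) val_eqE.
Qed.

Lemma walk_res_succ k p : p (pos k) = p (pos' k) ->
  walk_res p (pos k) = res_succ (walk_res p (pos' k)).
Proof.
move=> hp; rewrite !ffunE -hp res_succ_to /= (count_beforeS _ _ (pos k)) eqxx.
by congr to_residue; rewrite PoszD opprD addrA subrK.
Qed.
End Walks.

Section Period.
Variable e : nat.
Hypothesis period : forall m : nat, (0 < m < 6)%N -> (m%:Z != 0 %[mod e])%Z.
Implicit Types a b : residue e.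

Lemma iter_res_succ a m : iter m (@res_succ e) a = to_residue e (val a + m%:Z).
Proof.
elim: m => [|m IH]; first by rewrite addr0 val_residueK.
by rewrite iterS IH res_succ_to; congr to_residue; lia.
Qed.

Lemma iter_res_succ_neq a m : (0 < m < 6)%N -> iter m (@res_succ e) a == a = false.
Proof.
move=> hm; apply/negP; rewrite iter_res_succ -{2}(val_residueK a).
rewrite to_residue_eq -{2}[val a]addr0 eqz_modDl; exact/negP/period.
Qed.
End Period.

(** * The Khovanov-Lauda operators on functions of walks *)

Section Operators.
Variables (e n : nat) (J : bool -> residue e) (K : fieldType) (z : K).
Hypothesis period : forall m : nat, (0 < m < 6)%N -> (m%:Z != 0 %[mod e])%Z.
Hypothesis z_neq0 : z != 0.
Implicit Types (p : walk n) (k l : 'I_n.-1) (g : walk n -> K).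

Local Notation res := (walk_res J).

Definition yval (b : bool) : K := if b then z else 0.

Definition letter p (x : 'I_n) : bool * residue e := (p x, res p x).

(** The coefficients of g(p) and g(s_k p) in (psi_k g)(p).  For equal residues
    they form the divided difference; for a residue i followed by i - 1 the
    operator is the swap multiplied by y_k - y_(k+1), and otherwise the plain swap. *)
Definition psi_id (a b : bool * residue e) : K :=
  if a.2 == b.2 then (yval b.1 - yval a.1)^-1 else 0.

Definition psi_swap (a b : bool * residue e) : K :=
  if a.2 == b.2 then (yval a.1 - yval b.1)^-1
  else if a.2 == res_succ b.2 then yval a.1 - yval b.1 else 1.

(** Two consecutive steps into one column have residues i, i - 1 and equal y-values,
    so the factor y_k - y_(k+1) vanishes and the value is 0; this is
    why the operators restrict to walks, although the exchanged point is not a walk. *)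
Definition psi_at k g p : K :=
  if p (pos k) == p (pos' k) then 0
  else psi_id (letter p (pos k)) (letter p (pos' k)) * g p
     + psi_swap (letter p (pos k)) (letter p (pos' k)) * g (swap k p).

Lemma letter_swap k p x : p (pos k) != p (pos' k) ->
  letter (swap k p) x = letter p (transp k x).
Proof. by move=> h; rewrite /letter walk_res_swap // !ffunE. Qed.

Lemma psi_same k g p : p (pos k) = p (pos' k) -> psi_at k g p = 0.
Proof. by move=> h; rewrite /psi_at h eqxx. Qed.

Lemma psi_diff k g p : p (pos k) != p (pos' k) ->
  psi_at k g p = psi_id (letter p (pos k)) (letter p (pos' k)) * g p
     + psi_swap (letter p (pos k)) (letter p (pos' k)) * g (swap k p).
Proof. by move=> h; rewrite /psi_at (negPf h). Qed.

Lemma swap_neq k p : (swap k p (pos k) == swap k p (pos' k)) = (p (pos k) == p (pos' k)).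
Proof. by rewrite !ffunE transpL transpR eq_sym. Qed.

Lemma yval_neq a b : a != b -> yval a - yval b != 0.
Proof. by case: a b => [] [] //= _; rewrite /yval ?subr0 ?sub0r ?oppr_eq0. Qed.

Lemma succ_neq1 (a : residue e) : (res_succ a == a) = false.
Proof. exact: (iter_res_succ_neq period a (m := 1)). Qed.
Lemma succ_neq2 (a : residue e) : (res_succ (res_succ a) == a) = false.
Proof. exact: (iter_res_succ_neq period a (m := 2)). Qed.
Lemma succ_neq3 (a : residue e) : (res_succ (res_succ (res_succ a)) == a) = false.
Proof. exact: (iter_res_succ_neq period a (m := 3)). Qed.
Lemma succ_neq1' (a : residue e) : (a == res_succ a) = false.
Proof. by rewrite eq_sym succ_neq1. Qed.
Lemma succ_neq2' (a : residue e) : (a == res_succ (res_succ a)) = false.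
Proof. by rewrite eq_sym succ_neq2. Qed.
Lemma succ_neq3' (a : residue e) : (a == res_succ (res_succ (res_succ a))) = false.
Proof. by rewrite eq_sym succ_neq3. Qed.
Definition succ_neqE := (succ_neq1, succ_neq2, succ_neq3, succ_neq1', succ_neq2',
  succ_neq3', inj_eq (@res_succ_inj e), eqxx).

Lemma psi_psi k g p :
  psi_at k (psi_at k g) p =
  (if res p (pos k) == res p (pos' k) then 0
   else if res p (pos' k) == res_succ (res p (pos k)) then
     yval (p (pos' k)) - yval (p (pos k))
   else if res p (pos k) == res_succ (res p (pos' k)) then
     yval (p (pos k)) - yval (p (pos' k))
   else 1) * g p.
Proof.
have [h|h] := eqVneq (p (pos k)) (p (pos' k)).
  rewrite psi_same // (walk_res_succ _ h) h !succ_neqE.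
  by rewrite subrr mul0r.
rewrite psi_diff // [psi_at k g p]psi_diff // [psi_at k g (swap k p)]psi_diff ?swap_neq //.
rewrite swapK !letter_swap // transpL transpR /psi_id /psi_swap /letter /=.
move: (yval_neq h); move: (res p (pos k)) (res p (pos' k)) => x y.
set a := yval _; set b := yval _ => hab.
have hba : b - a != 0 by rewrite -opprB oppr_eq0.
have [_|_] := eqVneq x y; first by field; rewrite hab hba.
have [->|_] := eqVneq y (res_succ x); first by rewrite succ_neqE; ring.
by have [_|_] := eqVneq x (res_succ y); ring.
Qed.

(** Only the column patterns with exactly two equal letters matter, and in each of
    them most of the eight terms die by [psi_same].  A nonzero contribution needs the
    two outer residues to be equal; the inverse difference of y-values then cancels
    against the factor that the adjacent pair contributes. *)
Lemma psi_braid k l g p : k.+1 = l :> nat ->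
  psi_at k (psi_at l (psi_at k g)) p - psi_at l (psi_at k (psi_at l g)) p =
  (if (res p (pos' l) == res p (pos k)) && (res p (pos' k) == res_succ (res p (pos k)))
   then 1
   else if (res p (pos' l) == res p (pos k)) && (res p (pos k) == res_succ (res p (pos' k)))
   then -1 else 0) * g p.
Proof.
move=> kl.
have lE : pos' k = pos l by apply: val_inj.
have h13 : pos' l != pos k by rewrite -val_eqE /=; lia.
have h13' : pos' l != pos' k by rewrite -val_eqE /=; lia.
have h31 : pos k != pos l by rewrite -val_eqE /=; lia.
have h31' : pos k != pos' l by rewrite eq_sym.
have tE : (transp k (pos k) = pos l) * (transp k (pos l) = pos k) *
   (transp k (pos' l) = pos' l) * (transp l (pos k) = pos k) *
   (transp l (pos l) = pos' l) * (transp l (pos' l) = pos l).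
  by rewrite -{1 2}lE !transpL !transpR !transpD.
have sE q : swap k (swap l (swap k q)) = swap l (swap k (swap l q)).
  apply/ffunP => x; rewrite !ffunE; congr (q _).
  have [->|x1] := eqVneq x (pos k); first by rewrite !tE.
  have [->|x2] := eqVneq x (pos l); first by rewrite !tE.
  have [->|x3] := eqVneq x (pos' l); first by rewrite !tE.
  by rewrite !(@transpD _ k) ?lE // !(@transpD _ l) ?lE // (@transpD _ k) ?lE.
rewrite lE.
have [h12|h12] := eqVneq (p (pos k)) (p (pos l));
have [h23|h23] := eqVneq (p (pos l)) (p (pos' l)).
- rewrite psi_same ?lE // [X in _ - X]psi_same //.
  have := walk_res_succ J (p := p) (k := k); rewrite lE => /(_ h12) ->.
  have := walk_res_succ J (p := p) (k := l) => /(_ h23) ->.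
  by rewrite !succ_neqE /= subrr mul0r.
(* pattern b b c: only the term l k l survives *)
- rewrite psi_same ?lE // sub0r psi_diff //.
  rewrite psi_same ?lE // mulr0 add0r.
  have e1 : swap l p (pos k) != swap l p (pos' k).
    by rewrite lE !ffunE !tE h12.
  have e2 : swap k (swap l p) (pos l) = swap k (swap l p) (pos' l).
    by rewrite !ffunE !tE h12.
  rewrite psi_diff // lE [psi_at l g (swap k _)]psi_same // mulr0 addr0.
  rewrite psi_diff ?swap_neq // swapK !letter_swap // !tE /psi_id /psi_swap /letter /=.
  have := walk_res_succ J (p := p) (k := k); rewrite lE => /(_ h12) ->.
  rewrite h12; move: (yval_neq h23); move: (res p (pos l)) (res p (pos' l)) => x y.
  set a := yval _; set b := yval _ => hab.
  have hba : b - a != 0 by rewrite -opprB oppr_eq0.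
  have [<-|_] := eqVneq (res_succ x) y; last by rewrite !mul0r !mulr0 oppr0.
  by rewrite !succ_neqE /=; field; rewrite hba.
(* pattern c b b: only the term k l k survives *)
- rewrite [X in _ - X]psi_same // subr0 psi_diff ?lE //.
  rewrite psi_same // mulr0 add0r.
  have e1 : swap k p (pos l) != swap k p (pos' l) by rewrite !ffunE !tE -h23.
  have e2 : swap l (swap k p) (pos k) = swap l (swap k p) (pos' k).
    by rewrite lE !ffunE !tE h23.
  rewrite psi_diff // [psi_at k g (swap l _)]psi_same // mulr0 addr0.
  rewrite psi_diff ?swap_neq ?lE // swapK !letter_swap ?lE // !tE /psi_id /psi_swap /letter /=.
  have := walk_res_succ J (p := p) (k := l) => /(_ h23) ->.
  rewrite -h23; move: (yval_neq h12); move: (res p (pos k)) (res p (pos' l)) => x y.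
  set a := yval _; set b := yval _ => hab.
  have hba : b - a != 0 by rewrite -opprB oppr_eq0.
  have [<-|_] := eqVneq x y; last by rewrite /= !mul0r mulr0.
  by rewrite !succ_neqE /=; field; rewrite hba.
(* pattern b c b: a survivor would need three equal residues, but the outer two are i and i - 1 *)
- have h13b : p (pos k) = p (pos' l).
    by move: h12 h23; case: (p (pos k)); case: (p (pos l)); case: (p (pos' l)).
  have e1 : swap k p (pos l) = swap k p (pos' l) by rewrite !ffunE !tE.
  have e2 : swap l p (pos k) = swap l p (pos' k) by rewrite lE !ffunE !tE.
  have plE x : place (transp l) (res p) x = res p (transp l x) by rewrite [LHS]ffunE.
  have := walk_res_succ J e2; rewrite lE walk_res_swap // !plE !tE => resE.
  have A0 : psi_id (letter p (pos k)) (letter p (pos l)) *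
            psi_id (letter p (pos l)) (letter p (pos' l)) = 0.
    rewrite /psi_id /letter /= resE.
    have [<-|_] := eqVneq _ (res p (pos l)); last by rewrite mul0r.
    by rewrite succ_neqE mulr0.
  rewrite psi_diff ?lE // [psi_at l _ (swap k p)]psi_same // mulr0 addr0.
  rewrite psi_diff // [psi_at k g (swap l p)]psi_same // mulr0 addr0.
  rewrite mulrA A0 mul0r sub0r.
  rewrite psi_diff // [psi_at k _ (swap l p)]psi_same // mulr0 addr0.
  rewrite psi_diff ?lE // [psi_at l g (swap k p)]psi_same // mulr0 addr0.
  rewrite mulrA [X in X * _]mulrC A0 mul0r oppr0.
  by rewrite resE !succ_neqE mul0r.
Qed.

Definition y_at (x : 'I_n) g p : K := yval (p x) * g p.

(** Multiplication by a function of the residue sequence: e(i) for [pred1 i], and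
    the Kronecker delta of two neighbouring residues for [equal_pair] below. *)
Definition mask_at (h : pred (res_seq n e)) g p : K := (h (res p))%:R * g p.

Lemma psi_yD k (x : 'I_n) g p : x != pos k -> x != pos' k ->
  psi_at k (y_at x g) p = y_at x (psi_at k g) p.
Proof.
move=> x1 x2; rewrite /y_at; have [h|h] := eqVneq (p (pos k)) (p (pos' k)).
  by rewrite !psi_same // mulr0.
by rewrite !psi_diff // ffunE transpD //; ring.
Qed.

Lemma psi_yR k g p :
  psi_at k (y_at (pos' k) g) p =
  y_at (pos k) (psi_at k g) p + (res p (pos k) == res p (pos' k))%:R * g p.
Proof.
rewrite /y_at; have [h|h] := eqVneq (p (pos k)) (p (pos' k)).
  by rewrite !psi_same // (walk_res_succ J h) succ_neqE mulr0 mul0r addr0.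
rewrite !psi_diff //= ffunE transpR /psi_id /psi_swap /letter /=.
move: (yval_neq h); set a := yval _; set b := yval _ => hab.
have hba : b - a != 0 by rewrite -opprB oppr_eq0.
case: eqVneq => _; last by rewrite /=; ring.
by rewrite mul1r; field; rewrite hab hba.
Qed.

Lemma y_psiR k g p :
  y_at (pos' k) (psi_at k g) p =
  psi_at k (y_at (pos k) g) p + (res p (pos k) == res p (pos' k))%:R * g p.
Proof.
rewrite /y_at; have [h|h] := eqVneq (p (pos k)) (p (pos' k)).
  by rewrite !psi_same // (walk_res_succ J h) succ_neqE mulr0 mul0r addr0.
rewrite !psi_diff //= ffunE transpL /psi_id /psi_swap /letter /=.
move: (yval_neq h); set a := yval _; set b := yval _ => hab.
have hba : b - a != 0 by rewrite -opprB oppr_eq0.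
case: eqVneq => _; last by rewrite /=; ring.
by rewrite mul1r; field; rewrite hab hba.
Qed.

Lemma place_transp_id k (i : res_seq n e) : i (pos k) = i (pos' k) ->
  place (transp k) i = i.
Proof.
move=> h; apply/ffunP => x; rewrite ffunE /transp.
by case: tpermP => [->|->|].
Qed.

Lemma place_transpK k : involutive (@place n e (transp k)).
Proof. by move=> i; apply/ffunP => x; rewrite !ffunE transpK. Qed.

Lemma psi_mask k (h : pred (res_seq n e)) g p :
  psi_at k (mask_at h g) p =
  mask_at (fun i => h (place (transp k) i)) (psi_at k g) p.
Proof.
rewrite /mask_at; have [hp|hp] := eqVneq (p (pos k)) (p (pos' k)).
  by rewrite !psi_same // mulr0.
rewrite !psi_diff // walk_res_swap // /psi_id /letter /=.
case: eqVneq => hr; last by ring.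
by rewrite place_transp_id //; ring.
Qed.

Lemma swap_comm k l p : k.+1 != l :> nat -> l.+1 != k :> nat ->
  swap k (swap l p) = swap l (swap k p).
Proof.
move=> kl lk; apply/ffunP => x; rewrite !ffunE -!permM.
by rewrite transp_comm.
Qed.

Lemma psi_comm k l g p : k.+1 != l :> nat -> l.+1 != k :> nat ->
  psi_at k (psi_at l g) p = psi_at l (psi_at k g) p.
Proof.
move=> kl lk; have [->//|nkl] := eqVneq k l.
have nkl' : k != l :> nat by [].
have tE : (transp k (pos l) = pos l) * (transp k (pos' l) = pos' l)
   * (transp l (pos k) = pos k) * (transp l (pos' k) = pos' k).
  by rewrite !transpD // -val_eqE /=; lia.
have [h1|h1] := eqVneq (p (pos k)) (p (pos' k));
have [h2|h2] := eqVneq (p (pos l)) (p (pos' l)).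
- by rewrite !psi_same.
- rewrite psi_same // psi_diff // psi_same // psi_same; first by rewrite !mulr0 addr0.
  by rewrite !ffunE !tE.
- rewrite [RHS]psi_same // psi_diff // psi_same // psi_same; first by rewrite !mulr0 addr0.
  by rewrite !ffunE !tE.
have e1 : swap l p (pos k) != swap l p (pos' k) by rewrite !ffunE !tE.
have e2 : swap k p (pos l) != swap k p (pos' l) by rewrite !ffunE !tE.
rewrite psi_diff // [RHS]psi_diff // !(@psi_diff k g) // !(@psi_diff l g) //.
by rewrite !letter_swap // !tE swap_comm //; ring.
Qed.
End Operators.

(** * The action of the free algebra *)

Section Representation.
Variables (R : fieldType) (e n : nat) (J : bool -> residue e).
Variable O : {fset res_seq n e}.

Variables (K : fieldType) (iota : {rmorphism {poly R} -> K}).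
Local Notation z := (iota 'X).
Local Notation res := (walk_res J).

(** The field K and the embedding iota of R[z] are abstract; they are instantiated
    by the fraction field only in the last theorem. *)
Definition walk_space := {ffun walk n -> K^o}.
Implicit Types (g : walk_space) (k l : 'I_n.-1) (x : 'I_n).

Definition psi_fun k g : walk_space := [ffun p => psi_at J z k g p].
Definition y_fun x g : walk_space := [ffun p => y_at z x g p].
Definition mask_fun (h : pred (res_seq n e)) g : walk_space := [ffun p => mask_at J h g p].

Lemma psi_fun_linear k : linear (psi_fun k).
Proof.
move=> c f g; apply/ffunP => p; rewrite !ffunE /psi_at.
case: ifP => _; first by rewrite scaler0 addr0.
by rewrite !ffunE /GRing.scale /=; ring.
Qed.
Lemma y_fun_linear x : linear (y_fun x).
Proof.
by move=> c f g; apply/ffunP => p; rewrite !ffunE /y_at !ffunE /GRing.scale /=; ring.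
Qed.
Lemma mask_fun_linear h : linear (mask_fun h).
Proof.
by move=> c f g; apply/ffunP => p; rewrite !ffunE /mask_at !ffunE /GRing.scale /=; ring.
Qed.
HB.instance Definition _ k :=
  GRing.isLinear.Build K walk_space walk_space _ (psi_fun k) (psi_fun_linear k).
HB.instance Definition _ x :=
  GRing.isLinear.Build K walk_space walk_space _ (y_fun x) (y_fun_linear x).
HB.instance Definition _ h :=
  GRing.isLinear.Build K walk_space walk_space _ (mask_fun h) (mask_fun_linear h).

Lemma walk_space_proper : (0 < dim walk_space)%N.
Proof.
have -> : dim walk_space = \dim {: walk_space} by rewrite dimvf.
rewrite lt0n dimv_eq0; apply/negP => /eqP h.
have : ([ffun=> 1] : walk_space) \in (fullv : {vspace walk_space}) by exact: memvf.
rewrite h memv0 => /eqP /ffunP /(_ [ffun=> true]).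
by rewrite !ffunE => /eqP; rewrite oner_eq0.
Qed.

Definition walk_end : nzRingType := lfun_comp_nzRingType walk_space_proper.

Definition act_fun (a : walk_end) : walk_space -> walk_space := fun_of_lfun (a : 'End(walk_space)).

Lemma actM (a b : walk_end) g : act_fun (a * b) g = act_fun a (act_fun b g).
Proof. exact: comp_lfunE. Qed.
Lemma act1 g : act_fun 1 g = g.
Proof. exact: id_lfunE. Qed.
Lemma actD (a b : walk_end) g : act_fun (a + b) g = act_fun a g + act_fun b g.
Proof. exact: add_lfunE. Qed.
Lemma actN (a : walk_end) g : act_fun (- a) g = - act_fun a g.
Proof. exact: opp_lfunE. Qed.
Lemma act0 g : act_fun 0 g = 0.
Proof. exact: zero_lfunE. Qed.
Lemma act_is_linear (a : walk_end) : linear (act_fun a).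
Proof. by move=> c f g; rewrite /act_fun linearP. Qed.
HB.instance Definition _ a :=
  GRing.isLinear.Build K walk_space walk_space _ (act_fun a) (act_is_linear a).

Definition const_end (c : R) : walk_end := iota c%:P *: (\1%VF : 'End(walk_space)).

Lemma const_endE c g : act_fun (const_end c) g = iota c%:P *: g.
Proof. by rewrite /act_fun scale_lfunE id_lfunE. Qed.

Lemma const_end_is_additive : zmod_morphism const_end.
Proof. by move=> a b; rewrite /const_end rmorphB /= rmorphB /= scalerBl. Qed.
Lemma act_inj (a b : walk_end) : (forall g, act_fun a g = act_fun b g) -> a = b.
Proof. by move=> h; apply/lfunP. Qed.
Lemma const_end_is_monoid : monoid_morphism const_end.
Proof.
split=> [|a b]; apply: act_inj => g; first by rewrite const_endE act1 !rmorph1 scale1r.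
by rewrite actM !const_endE scalerA polyCM rmorphM.
Qed.
HB.instance Definition _ :=
  GRing.isZmodMorphism.Build R walk_end const_end const_end_is_additive.
HB.instance Definition _ :=
  GRing.isMonoidMorphism.Build R walk_end const_end const_end_is_monoid.

Lemma const_end_comm c (s : walk_end) : GRing.comm (const_end c) s.
Proof. by apply: act_inj => g; rewrite !actM !const_endE linearZ. Qed.

Definition gen_end (u : klr_gen O) : walk_end :=
  match u with
  | inl (inl k) => linfun (psi_fun k)
  | inl (inr x) => linfun (y_fun x)
  | inr i => linfun (mask_fun (pred1 (val i)))
  end.

Definition rep : klr_free R O -> walk_end := free_lift const_end gen_end.

Definition act (a : klr_free R O) (g : walk_space) : walk_space := act_fun (rep a) g.

Lemma act_add a b g : act (a + b) g = act a g + act b g.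
Proof. by rewrite /act [rep _]free_liftD actD. Qed.
Lemma act_sub a b g : act (a - b) g = act a g - act b g.
Proof. by rewrite /act [rep _]free_liftB actD actN. Qed.
Lemma act_zero g : act 0 g = 0.
Proof. by rewrite /act [rep _]free_lift0 act0. Qed.
Lemma act_one g : act 1 g = g.
Proof. by rewrite /act [rep _]free_lift1 act1. Qed.
Lemma act_opp a g : act (- a) g = - act a g.
Proof. by rewrite -sub0r act_sub act_zero sub0r. Qed.
Lemma act_mul a b g : act (a * b) g = act a (act b g).
Proof. by rewrite /act [rep _](@free_liftM _ _ _ _ _ const_end_comm) actM. Qed.
Lemma act_mul_eq a b f1 f2 g : (forall h, act a h = f1 h) ->
  (forall h, act b h = f2 h) -> act (a * b) g = f1 (f2 g).
Proof. by move=> ha hb; rewrite act_mul ha hb. Qed.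
Lemma act_exp a m g : act (a ^+ m) g = iter m (act a) g.
Proof. by elim: m => [|m IH]; rewrite ?act_one // exprS act_mul IH. Qed.
Lemma act_scalar c g : act (Defs.scalar c) g = iota c%:P *: g.
Proof. by rewrite /act [rep _]free_lift_scalar const_endE. Qed.
Lemma act_psi k g : act (fpsi R O k) g = psi_fun k g.
Proof. by rewrite /act [rep _]free_lift_gen [LHS]lfunE. Qed.
Lemma act_y x g : act (fy R O x) g = y_fun x g.
Proof. by rewrite /act [rep _]free_lift_gen [LHS]lfunE. Qed.
Lemma act_e (i : O) g : act (fe R i) g = mask_fun (pred1 (val i)) g.
Proof. by rewrite /act [rep _]free_lift_gen [LHS]lfunE. Qed.
Lemma act_sum (I : Type) (r : seq I) (F : I -> klr_free R O) g :
  act (\sum_(i <- r) F i) g = \sum_(i <- r) act (F i) g.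
Proof. by elim/big_rec2: _ => [|i a b _ <-]; rewrite ?act_zero ?act_add. Qed.
Lemma actZ a c g : act a (c *: g) = c *: act a g.
Proof. by rewrite /act linearZ. Qed.
End Representation.

(** * The stable lattice and its reduction modulo z *)

Section Lattice.
Variables (R : fieldType) (e n : nat) (J : bool -> residue e).
Variable O : {fset res_seq n e}.
Variables (K : fieldType) (iota : {rmorphism {poly R} -> K}).
Variable m : nat.
Hypothesis period : forall m : nat, (0 < m < 6)%N -> (m%:Z != 0 %[mod e])%Z.
Hypothesis orbit_place : forall i k, i \in O -> place (transp k) i \in O.
Hypothesis z_neq0 : iota 'X != 0.

Local Notation z := (iota 'X).
Local Notation res := (walk_res J).
Local Notation walk_space := (walk_space n K).
Local Notation act := (@act R e n J O K iota).
Local Notation psi_fun := (psi_fun J iota).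
Local Notation y_fun := (y_fun iota).
Local Notation mask_fun := (mask_fun J).

Implicit Types (p : walk n) (g : walk_space) (k l : 'I_n.-1) (x : 'I_n).

Local Notation taken p := (count_before (fun_of_fin p)).

(** Walks with m steps into column u whose residues lie in the block O. *)
Definition in_region p := (taken p true n == m) && (res p \in O).

Lemma in_region_swap k p : p (pos k) != p (pos' k) ->
  in_region (swap k p) = in_region p.
Proof.
move=> h; rewrite /in_region taken_swap; last by have := ltn_ord k; lia.
congr (_ && _); rewrite walk_res_swap //; apply/idP/idP; last exact: orbit_place.
by rewrite -{2}[res p](place_transpK k); exact: orbit_place.
Qed.

Definition block_indicator (i : res_seq n e) : walk_space :=
  [ffun p => (in_region p && (res p == i))%:R].

(** The R[z]-span of the functions P(y) e(i), with P a polynomial in the y's. *)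
Inductive lattice : walk_space -> Prop :=
| lattice_base i : lattice (block_indicator i)
| latticeD f g : lattice f -> lattice g -> lattice (f + g)
| latticeZ (c : {poly R}) g : lattice g -> lattice (iota c *: g)
| lattice_y x g : lattice g -> lattice (y_fun x g).

Lemma lattice0 : lattice 0.
Proof.
by rewrite -(scale0r (block_indicator [ffun=> J true])) -(rmorph0 iota);
  apply/latticeZ/lattice_base.
Qed.

Lemma latticeN g : lattice g -> lattice (- g).
Proof.
by rewrite -scaleN1r -(rmorph1 iota) -rmorphN; exact: latticeZ.
Qed.

Lemma lattice_int g p : lattice g -> exists c, g p = iota c.
Proof.
elim=> [i|f h _ [a ha] _ [b hb]|c h _ [a ha]|x h _ [a ha]]; rewrite ffunE.
- by exists (in_region p && (res p == i))%:R; rewrite rmorph_nat.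
- by exists (a + b); rewrite ha hb rmorphD.
- by exists (c * a); rewrite ha rmorphM.
- exists ((if p x then 'X else 0) * a); rewrite /y_at ha rmorphM.
  by case: (p x); rewrite ?rmorph0.
Qed.

Lemma lattice_supp g p : lattice g -> ~~ in_region p -> g p = 0.
Proof.
move=> + /negPf hp; elim=> [i|f h _ fp _ hp'|c h _ hp'|x h _ hp']; rewrite ffunE.
- by rewrite hp.
- by rewrite fp hp' addr0.
- by rewrite hp' scaler0.
- by rewrite /y_at hp' mulr0.
Qed.

Lemma lattice_mask h g : lattice g -> lattice (mask_fun h g).
Proof.
elim=> [i|f f' _ If _ If'|c f _ If|x f _ If].
- case hi : (h i).
    suff -> : mask_fun h (block_indicator i) = block_indicator i by exact: lattice_base.
    apply/ffunP => p; rewrite !ffunE /mask_at ffunE.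
    by have [->|_] := eqVneq (res p) i; rewrite ?andbF ?mulr0 // hi mul1r.
  suff -> : mask_fun h (block_indicator i) = 0 by exact: lattice0.
  apply/ffunP => p; rewrite !ffunE /mask_at ffunE.
  by have [->|_] := eqVneq (res p) i; rewrite ?andbF ?mulr0 // hi mul0r.
- by rewrite linearD; exact: latticeD.
- by rewrite linearZ; exact: latticeZ.
- suff -> : mask_fun h (y_fun x f) = y_fun x (mask_fun h f) by exact: lattice_y.
  by apply/ffunP => p; rewrite !ffunE /mask_at /y_at !ffunE /mask_at /y_at mulrCA.
Qed.

Definition equal_pair k : pred (res_seq n e) := fun i => i (pos k) == i (pos' k).

Lemma psi_fun_at k g p : psi_fun k g p = psi_at J z k g p.
Proof. by rewrite ffunE. Qed.

Lemma psi_at_ext k (f g : walk n -> K) p : (forall q, f q = g q) ->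
  psi_at J z k f p = psi_at J z k g p.
Proof. by move=> h; rewrite /psi_at !h. Qed.

Lemma psi_fun_yD k x g : x != pos k -> x != pos' k ->
  psi_fun k (y_fun x g) = y_fun x (psi_fun k g).
Proof.
move=> x1 x2; apply/ffunP => p; rewrite [LHS]ffunE [RHS]ffunE.
rewrite (psi_at_ext _ _ (g := y_at z x g)); last by move=> q; rewrite ffunE.
by rewrite psi_yD // /y_at ffunE.
Qed.

Lemma psi_fun_yR k g :
  psi_fun k (y_fun (pos' k) g) = y_fun (pos k) (psi_fun k g) + mask_fun (equal_pair k) g.
Proof.
apply/ffunP => p; rewrite [LHS]ffunE [RHS]ffunE.
rewrite (psi_at_ext _ _ (g := y_at z (pos' k) g)); last by move=> q; rewrite ffunE.
by rewrite psi_yR // /y_at !ffunE /y_at /mask_at !ffunE /equal_pair !ffunE.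
Qed.

Lemma y_fun_psiR k g :
  y_fun (pos' k) (psi_fun k g) = psi_fun k (y_fun (pos k) g) + mask_fun (equal_pair k) g.
Proof.
apply/ffunP => p; rewrite [LHS]ffunE [RHS]ffunE /y_at ffunE -/(y_at _ _ _ _) y_psiR //.
congr (_ + _); last by rewrite [RHS]ffunE.
rewrite [RHS]ffunE; apply: psi_at_ext => q; by rewrite ffunE.
Qed.

Lemma psi_fun_mask k h g :
  psi_fun k (mask_fun h g) = mask_fun (fun i => h (place (transp k) i)) (psi_fun k g).
Proof.
apply/ffunP => p; rewrite [LHS]ffunE [RHS]ffunE /mask_at ffunE -/(mask_at _ _ _ _).
rewrite -[RHS](psi_mask J z k h g p); by apply: psi_at_ext => q; rewrite ffunE.
Qed.

Lemma psi_fun_psi k l g p : psi_fun k (psi_fun l g) p = psi_at J z k (psi_at J z l g) p.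
Proof. by rewrite ffunE; apply: psi_at_ext => q; rewrite ffunE. Qed.

(** The base case of stability: psi_k maps e(i) to 0, to a difference of two y's
    times e(s_k i), or to e(s_k i). *)
Lemma lattice_psi_indicator k i : lattice (psi_fun k (block_indicator i)).
Proof.
pose i' := place (transp k) i.
have iE p : p (pos k) != p (pos' k) ->
    block_indicator i (swap k p) = block_indicator i' p.
  move=> hp; rewrite !ffunE in_region_swap // walk_res_swap //.
  by rewrite -(inj_eq (inv_inj (place_transpK k))) place_transpK.
have [hi|hi] := eqVneq (i (pos k)) (i (pos' k)).
  suff -> : psi_fun k (block_indicator i) = 0 by exact: lattice0.
  apply/ffunP => p; rewrite psi_fun_at ffunE.
  have [hp|hp] := eqVneq (p (pos k)) (p (pos' k)); first by rewrite psi_same.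
  rewrite psi_diff // iE // /i' place_transp_id // ffunE.
  have [hr|_] := eqVneq (res p) i; last by rewrite andbF !mulr0 addr0.
  rewrite /psi_id /psi_swap /letter /= hr hi eqxx -mulrDl.
  by rewrite -[in X in X * _]opprB invrN addNr mul0r.
have i'E p : res p = i' ->
    (res p (pos k) = i (pos' k)) * (res p (pos' k) = i (pos k)).
  by move->; rewrite /i' 2!ffunE transpL transpR.
have [hs|hs] := eqVneq (i (pos' k)) (res_succ (i (pos k))).
  suff -> : psi_fun k (block_indicator i) =
      y_fun (pos k) (block_indicator i') - y_fun (pos' k) (block_indicator i').
    by apply: latticeD; [|apply: latticeN]; apply/lattice_y/lattice_base.
  apply/ffunP => p; rewrite psi_fun_at !ffunE /y_at !ffunE -mulrBl.
  have [hp|hp] := eqVneq (p (pos k)) (p (pos' k)).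
    by rewrite psi_same // hp subrr mul0r.
  rewrite psi_diff // iE // !ffunE /psi_id /psi_swap /letter /=.
  have [hr|_] := eqVneq (res p) i'; last first.
    rewrite andbF !mulr0; have [hr'|_] := eqVneq (res p) i; last by rewrite andbF mulr0 addr0.
    by rewrite hr' (negPf hi) mul0r addr0.
  rewrite !(i'E p hr) eq_sym (negPf hi) mul0r add0r hs eqxx.
  by [].
suff -> : psi_fun k (block_indicator i) = block_indicator i' by exact: lattice_base.
apply/ffunP => p; rewrite psi_fun_at.
have [hp|hp] := eqVneq (p (pos k)) (p (pos' k)).
  rewrite psi_same // ffunE; have [hr|_] := eqVneq (res p) i'; last by rewrite andbF.
  by have := walk_res_succ J hp; rewrite !(i'E p hr) => h; rewrite h eqxx in hs.
rewrite psi_diff // iE // !ffunE /psi_id /psi_swap /letter /=.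
have [hr|_] := eqVneq (res p) i'; last first.
  rewrite andbF !mulr0; have [hr'|_] := eqVneq (res p) i; last by rewrite andbF mulr0 addr0.
  by rewrite hr' (negPf hi) mul0r addr0.
by rewrite !(i'E p hr) eq_sym (negPf hi) mul0r add0r (negPf hs) mul1r.
Qed.

(** Stability of polynomials under divided differences, by moving psi_k past one
    y at a time. *)
Lemma lattice_psi k g : lattice g -> lattice (psi_fun k g).
Proof.
elim=> [i|f f' _ If _ If'|c f _ If|x f Lf If].
- exact: lattice_psi_indicator.
- by rewrite linearD; exact: latticeD.
- by rewrite linearZ; exact: latticeZ.
have [->|x1] := eqVneq x (pos k).
  have -> : psi_fun k (y_fun (pos k) f) =
      y_fun (pos' k) (psi_fun k f) - mask_fun (equal_pair k) f.
    by rewrite y_fun_psiR addrK.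
  by apply: latticeD; [exact: lattice_y|exact/latticeN/lattice_mask].
have [->|x2] := eqVneq x (pos' k).
  by rewrite psi_fun_yR; apply: latticeD; [exact: lattice_y|exact: lattice_mask].
by rewrite psi_fun_yD //; exact: lattice_y.
Qed.

Lemma lattice_act a g : lattice g -> lattice (act a g).
Proof.
move=> Lg; rewrite /act /rep /free_lift /mmap.
elim/big_ind: _ => [|x y Lx Ly|w _]; first by rewrite act0; exact: lattice0.
  by rewrite actD; exact: latticeD.
rewrite actM const_endE; apply: latticeZ.
rewrite /word_val; elim: (w : seq _) => [|u v IH]; first by rewrite big_nil act1.
rewrite big_cons actM; case: u => [[k|x]|i].
- by rewrite [act_fun _ _]lfunE; exact: lattice_psi.
- by rewrite [act_fun _ _]lfunE; exact: lattice_y.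
- by rewrite [act_fun _ _]lfunE; exact: lattice_mask.
Qed.

Definition small g := exists2 h, lattice h & g = z *: h.

Lemma small0 : small 0.
Proof. by exists 0; rewrite ?scaler0 //; exact: lattice0. Qed.

Lemma smallD f g : small f -> small g -> small (f + g).
Proof.
move=> [f' Lf ->] [g' Lg ->]; exists (f' + g'); last by rewrite scalerDr.
exact: latticeD.
Qed.

Lemma smallZ c g : small g -> small (iota c *: g).
Proof.
move=> [h Lh ->]; exists (iota c *: h); first exact: latticeZ.
by rewrite !scalerA mulrC.
Qed.

Lemma small_act a g : small g -> small (act a g).
Proof.
by move=> [h Lh ->]; exists (act a h); rewrite ?actZ //; exact: lattice_act.
Qed.

(** The annihilator of L/zL, stated without forming the quotient. *)
Definition annih (a : klr_free R O) : Prop := forall g, lattice g -> small (act a g).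

Lemma annih0 : annih 0.
Proof. by move=> g _; rewrite act_zero; exact: small0. Qed.
Lemma annihD a b : annih a -> annih b -> annih (a + b).
Proof. by move=> ha hb g Lg; rewrite act_add; apply: smallD; auto. Qed.
Lemma annihMl a b : annih b -> annih (a * b).
Proof. by move=> hb g Lg; rewrite act_mul; apply/small_act/hb. Qed.
Lemma annihMr a b : annih a -> annih (a * b).
Proof. by move=> ha g Lg; rewrite act_mul; apply/ha/lattice_act. Qed.

Lemma annih_eq a b : (forall g, lattice g -> act a g = act b g) -> annih (a - b).
Proof. by move=> h g Lg; rewrite act_sub h // subrr; exact: small0. Qed.

Lemma mask_ext (h h' : pred (res_seq n e)) g :
  (forall p, h (res p) = h' (res p)) -> mask_fun h g = mask_fun h' g.
Proof. by move=> E; apply/ffunP => p; rewrite !ffunE /mask_at E. Qed.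

Lemma mask_fun_pt h g p : mask_fun h g p = (h (res p))%:R * g p.
Proof. by rewrite ffunE. Qed.

Lemma annih_e (i : O) : (forall p, in_region p -> res p != val i) -> annih (fe R i).
Proof.
move=> h g Lg; rewrite act_e.
suff -> : mask_fun (pred1 (val i)) g = 0 by exact: small0.
apply/ffunP => p; rewrite mask_fun_pt ffunE /=.
have [/h/negPf ->|hp] := boolP (in_region p); first by rewrite mul0r.
by rewrite (lattice_supp Lg hp) mulr0.
Qed.

Lemma y_iter_mask (x : 'I_n) t g p : iter t (y_fun x) g p = yval z (p x) ^+ t * g p.
Proof.
elim: t => [|t IH]; first by rewrite mul1r.
by rewrite iterS ffunE /y_at IH exprS mulrA.
Qed.

(** All walks with residues i start in the same column, so y_1 acts on e(i) as the
    scalar z or 0; a positive power of it is divisible by z on the lattice. *)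
Lemma annih_cyclotomic (Lam : weight e) x (i : O) :
  (forall b, 0 < Lam (J b))%N -> J true != J false -> x = 0%N :> nat ->
  annih (fy R O x ^+ Lam (val i x) * fe R i).
Proof.
move=> LamJ Jinj x0 g Lg; rewrite act_mul act_e act_exp.
rewrite (eq_iter (f' := y_fun x)); last by move=> h; rewrite act_y.
have first_res p : res p x = J (p x).
  by rewrite ffunE x0 count_before0 subr0 val_residueK.
case Li : (Lam (val i x)) => [|t].
  suff -> : mask_fun (pred1 (val i)) g = 0 by exact: small0.
  apply/ffunP => p; rewrite mask_fun_pt ffunE /=.
  have [E|_] := eqVneq (res p) (val i); last by rewrite mul0r.
  by have := LamJ (p x); rewrite -first_res E Li.
have -> : iter t.+1 (y_fun x) (mask_fun (pred1 (val i)) g) =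
   z *: (iota (if val i x == J true then 'X^t else 0) *: mask_fun (pred1 (val i)) g).
  apply/ffunP => p; rewrite y_iter_mask !ffunE /mask_at /=.
  have [E|_] := eqVneq (res p) (val i); last by rewrite mul0r mulr0 !scaler0.
  rewrite -E first_res; case: (p x) => /=; rewrite /GRing.scale /=.
    by rewrite eqxx rmorphXn exprS mulrA.
  by rewrite eq_sym (negPf Jinj) rmorph0 exprS !mul0r mulr0.
exists (iota (if val i x == J true then 'X^t else 0) *: mask_fun (pred1 (val i)) g) => //.
exact/latticeZ/lattice_mask.
Qed.

Lemma act_natr (b : bool) g : act b%:R g = b%:R *: g.
Proof. by case: b; rewrite ?act_one ?act_zero ?scale1r ?scale0r. Qed.

(** Every relation but the cyclotomic one holds exactly, and contributes 0.  The
    identity sum of the e(i) = 1 holds because lattice functions are supported on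
    the block. *)
Lemma annih_rel (Lam : weight e) (a b : klr_free R O) :
  (forall c, 0 < Lam (J c))%N -> J true != J false ->
  klr_rel Lam a b -> annih (a - b).
Proof.
move=> LamJ Jinj.
have actE (i : O) h : act (fe R i) h = mask_fun (pred1 (val i)) h := act_e J iota i h.
have actY (x : 'I_n) h : act (fy R O x) h = y_fun x h := act_y J O iota x h.
have actP k h : act (fpsi R O k) h = psi_fun k h := act_psi J O iota k h.
have delta_mask k (i : O) g : mask_fun (equal_pair k) (mask_fun (pred1 (val i)) g) =
    (val i (pos k) == val i (pos' k))%:R *: mask_fun (pred1 (val i)) g.
  apply/ffunP => p; rewrite mask_fun_pt [in RHS]ffunE mask_fun_pt /equal_pair /=.
  by have [->|_] := eqVneq (res p) (val i); rewrite ?mul0r ?mulr0 ?scaler0.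
case.
- by move=> k i k0; rewrite subr0; exact: annih_cyclotomic.
- move=> i i'; apply: annih_eq => g _; rewrite act_mul !act_e.
  apply/ffunP => p; rewrite !mask_fun_pt /=.
  have [<-|nii] := eqVneq i i'.
    by rewrite act_e mask_fun_pt /=; case: eqP; rewrite ?mul1r ?mul0r.
  rewrite act_zero ffunE; have [->|_] := eqVneq (res p) (val i); last by rewrite mul0r.
  by rewrite (inj_eq val_inj) (negPf nii) mul0r mulr0.
- apply: annih_eq => g Lg; rewrite act_one act_sum.
  apply/ffunP => p; rewrite sum_ffunE.
  have [hp|hp] := boolP (in_region p); last first.
    rewrite (lattice_supp Lg hp) big1 // => i _.
    by rewrite act_e mask_fun_pt (lattice_supp Lg hp) mulr0.
  have hO : res p \in O by case/andP: hp.
  rewrite (bigD1 [` hO]%fset) //= act_e mask_fun_pt /= eqxx mul1r.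
  rewrite big1 ?addr0 // => i hi; rewrite act_e mask_fun_pt /=.
  by have [E|_] := eqVneq (res p) (val i);
    [rewrite -val_eqE /= E eqxx in hi|rewrite mul0r].
- move=> i k; apply: annih_eq => g _.
  rewrite [LHS](act_mul_eq _ (actE i) (actY k)) [RHS](act_mul_eq _ (actY k) (actE i)).
  by apply/ffunP => p; rewrite !mask_fun_pt !ffunE /y_at mask_fun_pt mulrCA.
- move=> i i' k E; apply: annih_eq => g _.
  rewrite [LHS](act_mul_eq _ (actP k) (actE i)) [RHS](act_mul_eq _ (actE i') (actP k)).
  rewrite psi_fun_mask; apply: mask_ext => p /=; rewrite E.
  by rewrite -(inj_eq (inv_inj (place_transpK k))) place_transpK.
- move=> k l; apply: annih_eq => g _.
  rewrite [LHS](act_mul_eq _ (actY k) (actY l)) [RHS](act_mul_eq _ (actY l) (actY k)).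
  by apply/ffunP => p; rewrite !ffunE /y_at !ffunE /y_at mulrCA.
- move=> k l lk lk'; apply: annih_eq => g _.
  rewrite [LHS](act_mul_eq _ (actP k) (actY l)) [RHS](act_mul_eq _ (actY l) (actP k)).
  exact: psi_fun_yD.
- move=> k l kl lk; apply: annih_eq => g _.
  rewrite [LHS](act_mul_eq _ (actP k) (actP l)) [RHS](act_mul_eq _ (actP l) (actP k)).
  by apply/ffunP => p; rewrite !psi_fun_psi; exact: psi_comm.
- move=> k i; apply: annih_eq => g _.
  rewrite [LHS](act_mul_eq _ (fun h => act_mul_eq h (actP k) (actY _)) (actE i)).
  rewrite [RHS]act_mul (actE i) [RHS]act_add act_natr psi_fun_yR.
  congr (_ + _); first exact/esym/act_mul_eq.
  exact: delta_mask.
- move=> k i; apply: annih_eq => g _.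
  rewrite [LHS](act_mul_eq _ (fun h => act_mul_eq h (actY _) (actP k)) (actE i)).
  rewrite [RHS]act_mul (actE i) [RHS]act_add act_natr y_fun_psiR.
  congr (_ + _); first exact/esym/act_mul_eq.
  exact: delta_mask.
- move=> k i aa bb; apply: annih_eq => g _.
  rewrite [LHS]act_mul act_exp [act (fe R i) g]act_e [iter _ _ _]/= !act_psi.
  apply/ffunP => p; rewrite psi_fun_psi psi_psi // mask_fun_pt /=.
  have [E|nE] := eqVneq (res p) (val i); last first.
    rewrite mul0r mulr0; case: ifP => _; first by rewrite act_zero ffunE.
    case: ifP => _; last case: ifP => _.
    + by rewrite act_mul act_sub act_e !act_y !ffunE /y_at mask_fun_pt /= (negPf nE) mul0r !mulr0 subr0.
    + by rewrite act_mul act_sub act_e !act_y !ffunE /y_at mask_fun_pt /= (negPf nE) mul0r !mulr0 subr0.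
    + by rewrite act_e mask_fun_pt /= (negPf nE) mul0r.
  rewrite E -/aa -/bb mul1r.
  case: ifP => _; first by rewrite act_zero ffunE mul0r.
  case: ifP => _; last case: ifP => _.
  + by rewrite act_mul act_sub act_e !act_y !ffunE /y_at mask_fun_pt /= E eqxx mul1r mulrBl.
  + by rewrite act_mul act_sub act_e !act_y !ffunE /y_at mask_fun_pt /= E eqxx mul1r mulrBl.
  + by rewrite act_e mask_fun_pt /= E eqxx !mul1r.
- move=> k l i aa bb cc kl; apply: annih_eq => g _.
  rewrite [LHS]act_mul [act (fe R i) g]act_e [LHS]act_sub.
  rewrite [X in X - _]act_mul [X in X - _]act_mul [X in _ - X]act_mul [X in _ - X]act_mul !act_psi.
  set G := mask_fun _ g.
  have E3 u v w p : psi_fun u (psi_fun v (psi_fun w G)) p =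
      psi_at J z u (psi_at J z v (psi_at J z w G)) p.
    by rewrite psi_fun_psi; apply: psi_at_ext => q; apply: psi_at_ext => q'; rewrite ffunE.
  apply/ffunP => p.
  transitivity (psi_at J z k (psi_at J z l (psi_at J z k G)) p -
                psi_at J z l (psi_at J z k (psi_at J z l G)) p).
    by rewrite -!E3 !ffunE.
  rewrite psi_braid // /G mask_fun_pt /=.
  have [E|nE] := eqVneq (res p) (val i); last first.
    rewrite mul0r mulr0; case: ifP => _; last case: ifP => _.
    + by rewrite act_e mask_fun_pt /= (negPf nE) mul0r.
    + by rewrite act_opp act_e ffunE mask_fun_pt /= (negPf nE) mul0r oppr0.
    + by rewrite act_zero ffunE.
  rewrite E -/aa -/bb -/cc mul1r.
  case: ifP => _; last case: ifP => _.
  + by rewrite act_e mask_fun_pt /= E eqxx mul1r.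
  + by rewrite act_opp act_e ffunE mask_fun_pt /= E eqxx mul1r mulN1r.
  + by rewrite act_zero ffunE mul0r.
Qed.
End Lattice.

(** * Passing to the Temperley-Lieb quotient *)

Section IdealTransfer.
Variables (R : pzRingType) (A : pzAlgType R).

Definition two_sided (I : A -> Prop) : Prop :=
  [/\ I 0, forall x y, I x -> I y -> I (x + y), forall a x, I x -> I (a * x)
    & forall a x, I x -> I (x * a)].

Variables (S I : A -> Prop).
Hypothesis I_ideal : two_sided I.
Hypothesis S_sub : forall x, S x -> I x.

Lemma ideal_gen_sub x : ideal_gen S x -> I x.
Proof. by case: I_ideal => I0 ID Ml Mr; elim=> //; auto. Qed.

Definition quot_ideal (x : quot_alg S) : Prop := I (repr x).

Lemma quot_idealE (a : A) : quot_ideal (\pi_(quot_alg S) a) <-> I a.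
Proof.
case: I_ideal => I0 ID Ml Mr.
have h : I (repr (\pi_(quot_alg S) a) - a) by apply/ideal_gen_sub/quot_repr.
rewrite /quot_ideal; split=> Ia.
  rewrite -[a](subKr (repr (\pi_(quot_alg S) a))); apply: (ID) => //.
  by rewrite -mulN1r; apply: Ml.
by rewrite -[repr _](subrK a); apply: ID.
Qed.
End IdealTransfer.

Lemma quot_ideal_two_sided (R : pzRingType) (A : pzAlgType R) (S I : A -> Prop) :
  two_sided I -> (forall x, S x -> I x) -> two_sided (quot_ideal (S := S) I).
Proof.
move=> I_ideal SI; have E := quot_idealE I_ideal SI.
case: (I_ideal) => I0 ID Ml Mr.
have p0 : (0 : quot_alg S) = \pi_(quot_alg S) 0 by rewrite piE.
split=> [|x y|a x|a x].
- by rewrite p0; apply/E.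
- elim/quotW: x => x; elim/quotW: y => y.
  by rewrite quot_addE !E; exact: ID.
- elim/quotW: x => x; elim/quotW: a => a.
  by rewrite -quot_piM !E; exact: Ml.
- elim/quotW: x => x; elim/quotW: a => a.
  by rewrite -quot_piM !E; exact: Mr.
Qed.

Section Orbit.
Variables (n e : nat).

Lemma orbit_ofP (i i' : res_seq n e) :
  reflect (exists s : 'S_n, i' = place s i) (i' \in orbit_of i).
Proof.
apply: (iffP (imfsetP _ _ _ _)) => [[s _ ->]|[s ->]]; first by exists s.
by exists s => //; rewrite /= -topredE /= inE.
Qed.

Lemma place_mul (s t : 'S_n) (i : res_seq n e) :
  place s (place t i) = place (s * t)%g i.
Proof. by apply/ffunP => x; rewrite !ffunE permM. Qed.

Lemma orbit_of_refl (i : res_seq n e) : i \in orbit_of i.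
Proof. by apply/orbit_ofP; exists 1%g; apply/ffunP => x; rewrite ffunE perm1. Qed.

Lemma orbit_of_place (i i' : res_seq n e) s :
  i' \in orbit_of i -> place s i' \in orbit_of i.
Proof.
move=> /orbit_ofP [t ->]; apply/orbit_ofP; exists (s * t)%g.
exact: place_mul.
Qed.

Definition block_of (i : res_seq n e) : block n e :=
  exist _ (orbit_of i) (ex_intro _ i erefl).
End Orbit.

Section Separation.
Variables (e r : nat) (j : 'I_r -> residue e).
Hypothesis hj : forall a b : 'I_r, a != b -> (2 < res_dist (j a) (j b))%N.

(** The form in which the separation of the charges is used: columns are determined
    by residues up to an error of 2. *)
Lemma residue_sep (a b : 'I_r) (c d : int) : (`|(c - d)%R| <= 2)%N ->
  to_residue e (val (j a) + c) = to_residue e (val (j b) + d) -> a = b.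
Proof.
move=> cd E; apply/eqP; case: eqP => // /eqP/hj; rewrite ltnNge; case/negP.
have E' : to_residue e (val (j a) + (c - d)) = j b.
  apply/eqP; rewrite -(val_residueK (j b)) to_residue_eq -(eqz_modDr d) addrA subrK.
  by rewrite -to_residue_eq E.
apply: leq_trans (res_dist_le (val_residueK (j a)) E') _.
by rewrite (_ : _ - _ = - (c - d)) ?abszN //; ring.
Qed.

Lemma weight_of_gt0 (k : residue e) : (0 < weight_of j k)%N = [exists a, j a == k].
Proof.
rewrite /weight_of /fundamental_weight; apply/idP/existsP => [|[a ha]].
  rewrite lt0n sum_nat_eq0 negb_forall => /existsP [a /=].
  by case E: (j a == k) => //= _; exists a.
by rewrite (bigD1 a) //= ha.
Qed.
End Separation.

Section CellTransfer.
Variables (R : fieldType) (e r n : nat) (j : 'I_r -> residue e).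
Hypothesis hj : forall a b : 'I_r, a != b -> (2 < res_dist (j a) (j b))%N.
Variables (K : fieldType) (iota : {rmorphism {poly R} -> K}).
Hypothesis z_neq0 : iota 'X != 0.
Variables (u v : 'I_r) (m : nat) (i0 : res_seq n e).
Hypothesis uv : u != v.

Definition two_cols (b : bool) : 'I_r := if b then u else v.
Definition col_charge (b : bool) : residue e := j (two_cols b).

Local Notation Lam := (weight_of j).
Local Notation O := (orbit_of i0).
Local Notation annih := (@annih R e n col_charge O K iota m).

Lemma period_of_sep (t : nat) : (0 < t < 6)%N -> (t%:Z != 0 %[mod e])%Z.
Proof. exact: dist2_period (hj uv). Qed.

Lemma col_charge_inj : col_charge true != col_charge false.
Proof.
apply/eqP => E; move: uv; rewrite (residue_sep hj (a := u) (b := v) (c := 0) (d := 0)) ?eqxx //.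
by rewrite !addr0 !val_residueK.
Qed.

Lemma two_cols_inj : injective two_cols.
Proof.
by case=> [] [] //= E; move: uv; rewrite -?E ?E eqxx.
Qed.

Lemma weight_col_charge b : (0 < Lam (col_charge b))%N.
Proof. by rewrite weight_of_gt0; apply/existsP; exists (two_cols b). Qed.

Lemma orbit_place i k : i \in O -> place (transp k) i \in O.
Proof. exact: orbit_of_place. Qed.

Lemma annih_two_sided : two_sided (annih : klr_free R O -> Prop).
Proof.
split.
- exact: annih0.
- exact: annihD.
- move=> a x; apply: annihMl; [exact: period_of_sep|exact: orbit_place|exact: z_neq0].
- move=> a x; apply: annihMr; [exact: period_of_sep|exact: orbit_place|exact: z_neq0].
Qed.

Lemma annih_klr_rel (x : klr_free R O) :
  (exists a b, klr_rel Lam a b /\ x = a - b) -> annih x.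
Proof.
move=> [a [b [ab ->]]]; apply: annih_rel ab.
- exact: period_of_sep.
- exact: z_neq0.
- exact: weight_col_charge.
- exact: col_charge_inj.
Qed.

Definition ann_block (x : klr_block R Lam O) : Prop := quot_ideal annih x.

(** The algebra is a product over blocks; the module lives on the block of i0. *)
Definition ann_klr (x : klr R n Lam) : Prop := ann_block (x (block_of i0)).

Lemma ann_blockE (a : klr_free R O) : ann_block (\pi_(klr_block R Lam O) a) <-> annih a.
Proof. exact: quot_idealE annih_two_sided annih_klr_rel a. Qed.

Lemma ann_klr_two_sided : two_sided ann_klr.
Proof.
have [h0 hD hl hr] := quot_ideal_two_sided annih_two_sided annih_klr_rel.
split=> [|x y|a x|a x]; rewrite /ann_klr.
- exact: h0.
- exact: hD.
- exact: hl.
- exact: hr.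
Qed.

Lemma ann_klr_e (i : res_seq n e) :
  (forall p, in_region col_charge O m p -> walk_res col_charge p != i) -> ann_klr (klr_e R Lam i).
Proof.
move=> h; rewrite /ann_klr /klr_e; case: insubP => [i' _ i'E|_]; last first.
  by case: (quot_ideal_two_sided annih_two_sided annih_klr_rel).
by apply/ann_blockE/annih_e => p hp; rewrite i'E; exact: h.
Qed.

Local Notation taken p := (count_before (fun_of_fin p)).

Lemma walk_res0 (p : walk n) (x : 'I_n) : x = 0%N :> nat -> walk_res col_charge p x = col_charge (p x).
Proof. by move=> x0; rewrite ffunE x0 count_before0 subr0 val_residueK. Qed.

(** The second node of a column has residue one less than its charge, hence is not
    a charge of any column. *)
Lemma walk_res_repeat (p : walk n) (x : 'I_n) (a : 'I_r) :
  taken p (p x) x = 1%N -> walk_res col_charge p x != j a.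
Proof.
move=> h; apply/eqP; rewrite ffunE h -(val_residueK (j a)) -(addr0 (val (j a))) => E.
have ab := residue_sep hj (c := -1) (d := 0) isT E.
move/eqP: E; rewrite -ab eq_sym to_residue_eq -(eqz_modDr 1) addrC addrA addr0 addrNK.
by rewrite -{2}[val _]add0r eqz_modDr; exact/negP/(@period_of_sep 1).
Qed.

(** Among the first three steps of a walk two share a column, and the second of
    these has a residue outside the support of the weight; so three distinct
    residues from the support cannot occur.  A residue followed by its successor
    cannot start a walk since a column descends by one and the charges of distinct
    columns are not neighbours. *)
Lemma ann_klr_TL_gen x : TL_gen x -> ann_klr x.
Proof.
case=> [i x1 x2 h1 h2 _ E|i x1 x2 x3 h1 h2 h3 n12 n13 n23 l1 l2 l3];
  apply: ann_klr_e => p _; apply/eqP => iE; move: iE.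
  move=> iE; move: E; rewrite -iE (walk_res0 _ h1) => E.
  have t2 : taken p (p x2) x2 = (p x1 == p x2).
    by rewrite h2 -[1%N]/(0.+1) -h1 count_beforeS h1 count_before0.
  move: E; rewrite ffunE t2 -(val_residueK (col_charge (p x1))) res_succ_to.
  have [p12|p12] := eqVneq (p x1) (p x2).
    rewrite p12 => /eqP; rewrite to_residue_eq eqz_modDl.
    rewrite -(eqz_modDr 1) addNr eq_sym; exact/negP/(@period_of_sep 2).
  rewrite subr0 -[X in to_residue e X]addr0 => E.
  have := residue_sep hj (a := two_cols (p x2)) (b := two_cols (p x1)) (c := 0) (d := 1) isT E.
  by move/two_cols_inj => E'; rewrite E' eqxx in p12.
move: l1 l2 l3; rewrite !weight_of_gt0 => /existsP [a1 a1E] /existsP [a2 a2E] /existsP [a3 a3E] iE.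
have t2 : taken p (p x2) x2 = (p x1 == p x2).
  by rewrite h2 -[1%N]/(0.+1) -h1 count_beforeS h1 count_before0.
have t3 : taken p (p x3) x3 = ((p x1 == p x3) + (p x2 == p x3))%N.
  by rewrite h3 -[2%N]/(1.+1) -h2 count_beforeS h2 -[1%N]/(0.+1) -h1 count_beforeS h1 count_before0.
have [p12|p12] := eqVneq (p x1) (p x2).
  have := @walk_res_repeat p x2 a2; rewrite t2 p12 eqxx => /(_ erefl).
  by rewrite iE eq_sym a2E.
have := @walk_res_repeat p x3 a3; rewrite t3 iE (eqP a3E) eqxx => h.
suff : false by []; apply: h; move: p12; by case: (p x1); case: (p x2); case: (p x3).
Qed.

Definition ann_TL (x : TL R n Lam) : Prop := quot_ideal ann_klr x.

Lemma ann_TLE (y : klr R n Lam) : ann_TL (\pi_(TL R n Lam) y) <-> ann_klr y.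
Proof. exact: quot_idealE ann_klr_two_sided ann_klr_TL_gen y. Qed.

Lemma ann_TL_two_sided : two_sided ann_TL.
Proof. exact: quot_ideal_two_sided ann_klr_two_sided ann_klr_TL_gen. Qed.

Lemma ann_TL_e (i : res_seq n e) :
  (forall p, in_region col_charge O m p -> walk_res col_charge p != i) -> ann_TL (tl_e R Lam i).
Proof. by move=> h; apply/ann_TLE/ann_klr_e. Qed.

(** A relation rather than a function: on the block of i0 the element x is the class of
    the noncommutative polynomial a, so that membership in [ann_TL] passes to [annih]. *)
Definition lifts (x : TL R n Lam) (a : klr_free R O) : Prop :=
  exists y : klr R n Lam, x = \pi_(TL R n Lam) y /\
    y (block_of i0) = \pi_(klr_block R Lam O) a.

Lemma lifts_annih x a : lifts x a -> ann_TL x -> annih a.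
Proof.
by move=> [y [-> ya]] /ann_TLE; rewrite /ann_klr ya => /ann_blockE.
Qed.

Lemma lifts_mul x y a b : lifts x a -> lifts y b -> lifts (x * y) (a * b).
Proof.
move=> [x' [-> xa]] [y' [-> yb]]; exists (x' * y'); split; first by rewrite quot_piM.
by rewrite quot_piM -xa -yb.
Qed.

Lemma lifts_one : lifts 1 1.
Proof. by exists 1; split. Qed.

Lemma lifts_scalar c : lifts (Defs.scalar c) (Defs.scalar c).
Proof. by exists (Defs.scalar c); split. Qed.

Lemma lifts_opp x a : lifts x a -> lifts (- x) (- a).
Proof.
move=> h; rewrite -mulN1r -[- a]mulN1r; apply: lifts_mul => //.
exists (- 1); split; first by rewrite -[in RHS]sub0r; rewrite raddfB raddf0 sub0r.
by rewrite raddfN.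
Qed.

Lemma lifts_add x y a b : lifts x a -> lifts y b -> lifts (x + y) (a + b).
Proof.
move=> [x' [-> xa]] [y' [-> yb]]; exists (x' + y'); split; first by rewrite quot_addE.
by rewrite -quot_addE -xa -yb.
Qed.

Lemma lifts_psi k : lifts (tl_psi R Lam k) (fpsi R O k).
Proof. by exists (klr_psi R Lam k). Qed.

Lemma lifts_word (s : seq 'I_n.-1) :
  lifts (psi_word R j s) (\prod_(k <- s) fpsi R O k).
Proof.
rewrite /psi_word; elim: s => [|k s IH]; first by rewrite !big_nil; exact: lifts_one.
by rewrite !big_cons; apply: lifts_mul => //; exact: lifts_psi.
Qed.

Lemma lifts_e (i : O) : lifts (tl_e R Lam (val i)) (fe R i).
Proof.
exists (klr_e R Lam (val i)); split=> //.
by rewrite /klr_e valK.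
Qed.
End CellTransfer.

(** * The initial tableau *)

Section RowReading.
Variables (r n : nat).
Implicit Types (mu : ocpart r n) (g : node r n) (k l : 'I_n) (c : 'I_r).

Local Notation nle := (fun g h : node r n => node_le (to_pair g) (to_pair h)).

Lemma node_le_trans : transitive nle.
Proof. by move=> [a x] [b y] [c z]; rewrite /node_le /=; lia. Qed.

Lemma node_le_total : total nle.
Proof. by move=> [a x] [b y]; rewrite /node_le /=; lia. Qed.

Lemma node_le_refl : reflexive nle.
Proof. by move=> [a x]; rewrite /node_le /=; lia. Qed.

Lemma node_le_anti : antisymmetric nle.
Proof.
move=> [a x] [b y]; rewrite /node_le /= => h.
have [h1 h2] : (a = b :> nat) /\ (x = y :> nat) by lia.
by congr (_, _); apply: val_inj.
Qed.

Lemma comp_size_le mu c : (comp_size mu c <= n)%N.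
Proof. by rewrite -ltnS ltn_ord. Qed.

Lemma tab_initE mu g0 k : tab_init mu k = nth g0 (node_seq mu) k.
Proof. by rewrite ffunE (tnth_nth g0). Qed.

Lemma node_seq_uniq mu : uniq (node_seq mu).
Proof. by rewrite sort_uniq enum_uniq. Qed.

Lemma size_nodes mu : size (node_seq mu) = n.
Proof. exact/eqP/size_node_seq. Qed.

Lemma mem_node_seq mu g : (g \in node_seq mu) = (g \in nodes mu).
Proof. by rewrite mem_sort mem_enum. Qed.

Lemma tab_init_inj mu : injective (tab_init mu).
Proof.
move=> k l; rewrite (tab_initE mu (tab_init mu k)) (tab_initE mu (tab_init mu k) l).
move/eqP; rewrite nth_uniq ?size_nodes ?node_seq_uniq //.
by move/eqP/val_inj.
Qed.

Lemma tab_init_mem mu k : tab_init mu k \in nodes mu.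
Proof.
by rewrite -mem_node_seq (tab_initE mu (tab_init mu k)) mem_nth // size_nodes.
Qed.

Lemma tab_init_surj mu g : g \in nodes mu -> exists k, tab_init mu k = g.
Proof.
rewrite -mem_node_seq => h; have hi := h; rewrite -index_mem size_nodes in hi.
by exists (Ordinal hi); rewrite (tab_initE mu g) /= nth_index.
Qed.

Lemma tab_init_le mu k l : (k <= l)%N -> nle (tab_init mu k) (tab_init mu l).
Proof.
have g0 := tab_init mu k; rewrite !(tab_initE mu g0) => kl.
apply: (sorted_leq_nth node_le_trans node_le_refl) => //; rewrite ?inE ?size_nodes //.
exact: (sort_sorted node_le_total).
Qed.

Lemma tab_init_lt mu k l : ~~ nle (tab_init mu k) (tab_init mu l) -> (l < k)%N.
Proof. by move=> h; rewrite ltnNge; apply: contra h; exact: tab_init_le. Qed.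

Lemma nodes_row mu g : (g \in nodes mu) = (0 < g.1 <= comp_size mu g.2)%N.
Proof. by rewrite inE. Qed.

Lemma tab_init_ltE mu k l : (tab_init mu k).2 = (tab_init mu l).2 ->
  (k < l)%N = ((tab_init mu k).1 < (tab_init mu l).1)%N.
Proof.
move=> E; apply/idP/idP => [kl|].
  have := tab_init_le mu (ltnW kl).
  have : tab_init mu k != tab_init mu l.
    by rewrite (inj_eq (@tab_init_inj mu)) -val_eqE /=; lia.
  move: E; case: (tab_init mu k) => a x; case: (tab_init mu l) => b y /= ->.
  by rewrite xpair_eqE eqxx andbT -val_eqE /node_le /=; lia.
move=> h; apply: (@tab_init_lt mu); move: h E.
by case: (tab_init mu k) => a x; case: (tab_init mu l) => b y /= ? ->; rewrite /node_le /=; lia.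
Qed.

Definition column c (s : nat) : {set node r n} :=
  [set g : node r n | (g.2 == c) && (0 < g.1 <= s)%N].

Lemma card_column c s : (s <= n)%N -> #|column c s| = s.
Proof.
move=> sn.
have hs (i : 'I_s) : (i.+1 < n.+1)%N by rewrite ltnS (leq_trans _ sn).
pose f (i : 'I_s) : node r n := (Ordinal (hs i), c).
have f_inj : injective f by move=> i i' [] /val_inj.
rewrite -[RHS]card_ord -(card_imset _ f_inj); congr #|pred_of_set _|.
apply/setP => -[a x]; rewrite inE /=; apply/idP/imsetP => [|[i _ [-> ->]]].
  move=> /andP [/eqP -> ha].
  have hi : (a.-1 < s)%N by lia.
  exists (Ordinal hi) => //; congr (_, _); apply: val_inj => /=; lia.
by rewrite eqxx /= ltn_ord.
Qed.

Local Notation col_count mu := (count_before (fun l => (tab_init mu l).2)).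

Lemma col_count_card mu c m :
  col_count mu c m = #|[set l : 'I_n | (l < m)%N && ((tab_init mu l).2 == c)]|.
Proof.
rewrite /count_before -sum1_card [RHS]big_mkcond /=.
by apply: eq_bigr => l _; rewrite inE; case: ifP.
Qed.

(** The tableau t^mu fills every column from the top, so the row of a node counts
    the earlier nodes of its column. *)
Lemma tab_init_row mu k :
  (tab_init mu k).1 = (col_count mu (tab_init mu k).2 k).+1 :> nat.
Proof.
have /[!nodes_row] /andP [h0 h1] := tab_init_mem mu k.
rewrite col_count_card -(card_imset _ (@tab_init_inj mu)).
suff -> : tab_init mu @: [set l : 'I_n | (l < k)%N && ((tab_init mu l).2 == (tab_init mu k).2)]
   = column (tab_init mu k).2 ((tab_init mu k).1.-1).
  rewrite card_column; first by rewrite prednK.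
  by have := ltn_ord (tab_init mu k).1; lia.
apply/setP => g; rewrite inE; apply/imsetP/idP => [[l /[!inE] /andP [lk /eqP c] ->]|].
  move: lk; rewrite (tab_init_ltE c) c eqxx /=.
  by have /[!nodes_row] /andP [? ?] := tab_init_mem mu l; lia.
move=> /andP [/eqP gc gr].
have /tab_init_surj [l lE] : g \in nodes mu by rewrite nodes_row gc; lia.
by exists l => //; rewrite inE (@tab_init_ltE mu) lE gc ?eqxx ?andbT //=; lia.
Qed.

Lemma col_count_total mu c : col_count mu c n = comp_size mu c.
Proof.
rewrite col_count_card -(card_imset _ (@tab_init_inj mu)) -(card_column c (comp_size_le mu c)).
congr #|pred_of_set _|; apply/setP => g; rewrite inE.
apply/imsetP/idP => [[l /[!inE] /andP [_ /eqP <-] ->]|/andP [/eqP gc gr]].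
  by rewrite eqxx /=; have := tab_init_mem mu l; rewrite nodes_row.
have /tab_init_surj [l lE] : g \in nodes mu by rewrite nodes_row gc.
by exists l => //; rewrite inE ltn_ord lE gc eqxx.
Qed.

(** Those nodes of a column that precede step k are its topmost ones. *)
Lemma before_row mu k l :
  (l < k)%N = ((tab_init mu l).1 <= col_count mu (tab_init mu l).2 k)%N.
Proof.
rewrite tab_init_row; apply/idP/idP => [lk|].
  by apply: leq_trans (count_before_mono _ _ lk); rewrite count_beforeS eqxx addn1.
by rewrite [(l < k)%N]ltnNge; apply: contraL => kl; rewrite -leqNgt count_before_mono.
Qed.

Lemma tab_resE e (j : 'I_r -> residue e) mu k :
  tab_res j mu k =
  to_residue e (val (j (tab_init mu k).2) - (col_count mu (tab_init mu k).2 k)%:Z).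
Proof.
by rewrite ffunE /node_res tab_init_row; congr to_residue; rewrite -addn1 PoszD; ring.
Qed.

Lemma eq_comp_size mu nu : (forall c, comp_size mu c = comp_size nu c) -> mu = nu.
Proof. by move=> h; apply: val_inj; apply/ffunP => c; apply: val_inj; exact: h. Qed.

Lemma sum_comp_size mu : (\sum_c comp_size mu c = n)%N.
Proof. exact/eqP/(valP mu). Qed.
End RowReading.

(** * Walks that follow the residues of an initial tableau *)

Section ResidueMatching.
Variables (e r n : nat) (j : 'I_r -> residue e).
Hypothesis hj : forall a b : 'I_r, a != b -> (2 < res_dist (j a) (j b))%N.
Variables (u v : 'I_r).
Hypothesis uv : (u < v)%N.
Variable lam : ocpart r n.
Hypothesis hcomp : forall l : 'I_r, (0 < comp_size lam l)%N = (l == u) || (l == v).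

Local Notation col := (two_cols u v).
Local Notation J := (col_charge j u v).
Local Notation i0 := (tab_res j lam).

Local Notation taken p := (count_before (fun_of_fin p)).
Local Notation col_count mu := (count_before (fun l => (tab_init mu l).2)).

Lemma uv_neq : u != v.
Proof. by rewrite -val_eqE neq_ltn uv. Qed.

Lemma col_cases c : (exists b, c = col b) \/ comp_size lam c = 0%N.
Proof.
have := hcomp c; case: (eqVneq c u) => [-> _|_ /=]; first by left; exists true.
case: (eqVneq c v) => [-> _|_ /=]; first by left; exists false.
by case: (comp_size lam c) => //; right.
Qed.

Lemma lam_sum : (comp_size lam u + comp_size lam v = n)%N.
Proof.
rewrite -[RHS](sum_comp_size lam) (bigD1 u) //= (bigD1 v) 1?eq_sym ?uv_neq //=.
rewrite big1 ?addn0 // => c /andP [cu cv].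
by have := hcomp c; rewrite (negPf cu) (negPf cv); case: (comp_size lam c).
Qed.

Lemma taken_comp_size (p : walk n) b : taken p true n = comp_size lam u ->
  taken p b n = comp_size lam (col b).
Proof.
move=> h; case: b => //=; have := taken_total p (leqnn n); have := lam_sum.
rewrite h; lia.
Qed.

Definition tab_walk : walk n := [ffun k => (tab_init lam k).2 == u].

Lemma tab_walk_col k : (tab_init lam k).2 = col (tab_walk k).
Proof.
rewrite [tab_walk k]ffunE; case: (eqVneq (tab_init lam k).2 u) => [->//|h].
case: (col_cases (tab_init lam k).2) => [[[] E]|E] //=; first by rewrite E eqxx in h.
by have := tab_init_mem lam k; rewrite nodes_row E; lia.
Qed.

Lemma tab_walk_taken b m : taken tab_walk b m = col_count lam (col b) m.
Proof.
apply: eq_bigr => l _; rewrite tab_walk_col.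
by rewrite (inj_eq (two_cols_inj uv_neq)).
Qed.

Lemma tab_walk_res : walk_res J tab_walk = i0.
Proof.
apply/ffunP => k; rewrite tab_resE [LHS]ffunE tab_walk_taken /col_charge.
by rewrite -tab_walk_col.
Qed.

Lemma tab_walk_region : in_region J (orbit_of i0) (comp_size lam u) tab_walk.
Proof.
by rewrite /in_region tab_walk_taken col_count_total eqxx tab_walk_res orbit_of_refl.
Qed.

Section MatchingWalk.
Variables (mu : ocpart r n) (p : walk n).
Hypothesis p_count : taken p true n = comp_size lam u.
Hypothesis p_res : walk_res J p = tab_res j mu.
Hypothesis dom : dominated mu lam.

Lemma res_eq_at k :
  to_residue e (val (j (tab_init mu k).2) - (col_count mu (tab_init mu k).2 k)%:Z) =
  to_residue e (val (j (col (p k))) - (taken p (p k) k)%:Z).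
Proof. by have /ffunP/(_ k) := p_res; rewrite tab_resE ffunE /col_charge => ->. Qed.

Section Step.
Variable k : 'I_n.
Hypothesis IH : forall l : 'I_n, (l < k)%N -> (tab_init mu l).2 = col (p l).

Lemma match_count b : col_count mu (col b) k = taken p b k.
Proof.
apply: eq_bigr => l _; case: (ltnP l k) => //= lk.
by rewrite IH // (inj_eq (two_cols_inj uv_neq)).
Qed.

(** Suppose that t^mu puts its k-th node in column c and the walk in c', with N and
    N' earlier nodes there.  Row reading gives N' <= N + 1, equality of residues and
    separation of charges improve this to N' < N.  Since t^mu fills row N + 1 while
    column c' has only N' nodes, column c' of mu is exhausted.  The walk still adds to
    c', so lambda has two nodes in each of the first N' + 1 rows and mu misses the
    last of them: this contradicts dominance. *)
Lemma match_step : (tab_init mu k).2 = col (p k).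
Proof.
set t := tab_init mu; set c := (t k).2; set c' := col (p k).
set N := col_count mu c k; set N' := taken p (p k) k.
have rowk : (t k).1 = N.+1 :> nat by exact: tab_init_row.
have N'E : col_count mu c' k = N' by exact: match_count.
apply/eqP; case: (eqVneq c c') => // cc'.
have N'_le : (N' <= N.+1)%N.
  case N'0 : N' => [//|s].
  have N'_le : (N' <= comp_size mu c')%N.
    by rewrite -N'E -col_count_total; apply: count_before_mono; exact/ltnW.
  have hN' : (N' < n.+1)%N by rewrite ltnS (leq_trans N'_le) // comp_size_le.
  have /tab_init_surj [l lE] : (Ordinal hN', c') \in nodes mu.
    by rewrite nodes_row /= N'_le N'0.
  have lk : (l < k)%N by rewrite (before_row mu) lE /= N'E.
  have := tab_init_le mu (ltnW lk); rewrite lE /node_le /= rowk; lia.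
(* otherwise the equal residues would identify the two columns *)
have sep : ~~ (`|(- N%:Z - - N'%:Z)%R| <= 2)%N.
  by apply/negP => h; move/eqP: cc'; apply; exact: (residue_sep hj h (res_eq_at k)).
have N'_lt : (N' < N)%N by move: sep N'_le; lia.
have [b cE] : exists b, c = col b.
  have : (0 < N)%N by lia.
  rewrite /N /count_before lt0n sum_nat_eq0 negb_forall => /existsP [l].
  rewrite negb_imply /= eqb0 negbK => /andP [lk /eqP <-].
  by exists (p l); exact: IH.
have bE : b = ~~ p k.
  by move: cc'; rewrite cE (inj_eq (two_cols_inj uv_neq)); case: (b); case: (p k).
have NE : taken p b k = N by rewrite -match_count -cE.
(* a further node of c' would come before step k in row reading *)
have mu_c' : (comp_size mu c' <= N')%N.
  rewrite leqNgt; apply/negP => h.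
  have hN' : (N'.+1 < n.+1)%N by rewrite ltnS (leq_trans h) // comp_size_le.
  have /tab_init_surj [l lE] : (Ordinal hN', c') \in nodes mu by rewrite nodes_row.
  have kl : (k <= l)%N by rewrite leqNgt (before_row mu) lE /= N'E ltnn.
  have := tab_init_le mu kl; rewrite lE /node_le /= rowk; lia.
(* compare the numbers of nodes in the first N' + 1 rows; v is the later column *)
have /= := dom (N'.+1, v).
have Nn : (N <= n)%N by rewrite -NE (leq_trans (count_before_mono _ _ (ltnW (ltn_ord k)))) //;
  have := taken_total p (leqnn n); case: (b); lia.
have lam_c : (N'.+1 <= comp_size lam c)%N.
  rewrite cE -(taken_comp_size _ p_count); apply: leq_trans N'_lt _.
  by rewrite -NE; apply: count_before_mono; exact/ltnW.
have lam_c' : (N'.+1 <= comp_size lam c')%N.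
  rewrite -(taken_comp_size _ p_count); apply: leq_trans (count_before_mono _ _ (ltn_ord k)).
  by rewrite count_beforeS eqxx addn1.
have disj s s' : [disjoint column n c s & column n c' s'].
  apply/pred0P => g /=; rewrite !inE; case: eqP => //= ->.
  by rewrite (negPf cc') andbF.
have cv x : x \in [:: c; c'] -> (x <= v)%N.
  by rewrite !inE cE => /orP [] /eqP ->; rewrite /c' /two_cols; case: ifP => _ //; exact/ltnW.
have hlam : (N'.+1 + N'.+1 <=
    #|[set g in nodes lam | node_le (to_pair g) (N'.+1, v)]|)%N.
  have -> : (N'.+1 + N'.+1)%N = #|column n c N'.+1 :|: column n c' N'.+1|.
    rewrite cardsU (disjoint_setI0 (disj _ _)) cards0 subn0.
    by rewrite !card_column ?(leq_trans N'_lt).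
  apply/subset_leq_card/subsetP => g; rewrite !inE /node_le /= => /orP [] /andP [/eqP gE hg].
    rewrite gE; have := cv c; rewrite !inE eqxx => /(_ isT); lia.
  rewrite gE; have := cv c'; rewrite !inE eqxx orbT => /(_ isT); lia.
have hmu : (#|[set g in nodes mu | node_le (to_pair g) (N'.+1, v)]| <= N'.+1 + N')%N.
  rewrite -[X in (_ <= X + _)%N](@card_column r n c N'.+1) ?(leq_trans N'_lt) //.
  rewrite -[X in (_ <= _ + X)%N](@card_column r n c' N') ?(leq_trans (ltnW N'_lt)) //.
  apply: leq_trans (leq_card_setU _ _).
  apply/subset_leq_card/subsetP => g; rewrite inE => /andP [gmu gle].
  have grow : (g.1 <= N'.+1)%N by move: gle; rewrite /node_le /=; lia.
  have [l lE] := tab_init_surj gmu.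
  have lk : (l < k)%N.
    apply: (@tab_init_lt _ _ mu); rewrite lE /node_le /= rowk.
    have gN : (g.1 < N.+1)%N by rewrite ltnS (leq_trans grow).
    by rewrite ltnNge (ltnW gN) /= gtn_eqF.
  have gc := IH lk; rewrite -/t lE in gc.
  move: gmu; rewrite nodes_row !inE gc => /andP [g0 g1].
  have [pp|pp] := eqVneq (p l) (p k).
    by move: g1; rewrite pp eqxx g0 -/c'; lia.
  have -> : p l = b by rewrite bE; move: pp; case: (p l); case: (p k).
  by rewrite -cE eqxx g0 grow.
by move=> dom_v; have := leq_trans (leq_trans hlam dom_v) hmu; rewrite leq_add2l ltnn.
Qed.
End Step.

Lemma match_all k : (tab_init mu k).2 = col (p k).
Proof.
have [t] := ubnP (k : nat); elim: t k => // t IH k; rewrite ltnS => kt.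
by apply: match_step => l lk; apply: IH; exact: leq_trans lk kt.
Qed.

Lemma match_shape : mu = lam.
Proof.
apply: eq_comp_size => c; rewrite -col_count_total.
have E b : col_count mu (col b) n = comp_size lam (col b).
  rewrite -(taken_comp_size _ p_count); apply: eq_bigr => l _.
  by rewrite match_all (inj_eq (two_cols_inj uv_neq)).
case: (col_cases c) => [[b ->]|c0] //; rewrite c0.
apply: big1 => l _; rewrite match_all; case: eqP => [cE|_]; last by rewrite andbF.
have := hcomp c; rewrite c0 -cE /two_cols; case: ifP => _; by rewrite eqxx ?orbT.
Qed.
End MatchingWalk.

Lemma lower_res_avoid (mu : ocpart r n) (p : walk n) : strictly_dominated mu lam ->
  in_region J (orbit_of i0) (comp_size lam u) p -> walk_res J p != tab_res j mu.
Proof.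
move=> [dom ne] /andP [/eqP p_count _]; apply/eqP => p_res.
by apply: ne; exact: match_shape p_count p_res dom.
Qed.
End ResidueMatching.

(** * Reduced words of 321-avoiding permutations *)

Section Words.
Variable n : nat.
Implicit Types (w : seq 'I_n.-1) (k l : 'I_n.-1) (d : 'S_n).

Lemma word_perm_nil : word_perm [::] = 1%g :> 'S_n.
Proof. by rewrite /word_perm big_nil. Qed.

Lemma word_perm_cons k w : word_perm (k :: w) = (word_perm w * transp k)%g.
Proof. by rewrite /word_perm rev_cons -cats1 big_cat big_seq1. Qed.

Lemma word_perm_rcons w k : word_perm (rcons w k) = (transp k * word_perm w)%g.
Proof. by rewrite /word_perm rev_rcons big_cons. Qed.

Lemma transp_sq k : (transp k * transp k)%g = 1%g.
Proof. exact: tperm2. Qed.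

Definition descent d k : bool := (d (pos' k) < d (pos k))%N.

(** The strands that start at k and k + 1 have crossed; deleting the letter of that
    crossing gives the shorter word.  The induction locates this letter: it is the
    head of the word as soon as the rest does not yet exchange the two strands. *)
Lemma exchange w k : descent (word_perm w) k ->
  exists2 w', size w = (size w').+1 & word_perm w' = word_perm (rcons w k).
Proof.
elim: w => [|a w IH]; first by rewrite /descent word_perm_nil !perm1 /=; lia.
rewrite /descent word_perm_cons !permM => desc.
case: (ltnP (word_perm w (pos' k)) (word_perm w (pos k))) => [/IH [w' sw pw]|asc].
  exists (a :: w'); first by rewrite /= sw.
  by rewrite rcons_cons !word_perm_cons pw.
have neq : word_perm w (pos k) != word_perm w (pos' k).
  by rewrite (inj_eq perm_inj) pos_neq.
exists w => //; rewrite rcons_cons word_perm_cons word_perm_rcons.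
suff aE : transp a = (transp k ^ word_perm w)%g.
  by rewrite -mulgA aE -conjgC mulgA transp_sq mul1g.
rewrite /transp tpermJ; move: desc asc neq; rewrite -val_eqE /=.
move: (word_perm w (pos k)) (word_perm w (pos' k)) => x y.
rewrite /transp; case: (tpermP _ _ x) => [->|->|/eqP x1 /eqP x2];
  case: (tpermP _ _ y) => [->|->|/eqP y1 /eqP y2] //=;
  move: x1 x2 y1 y2 || move: x1 x2 || move: y1 y2 || idtac;
  rewrite -?val_eqE /=; lia.
Qed.

Lemma reduced_prefix w k : reduced (rcons w k) -> reduced w.
Proof.
move=> red w' E; have := red (rcons w' k); rewrite !word_perm_rcons E => /(_ erefl).
by rewrite !size_rcons ltnS.
Qed.

Lemma reduced_descent w k : reduced (rcons w k) -> descent (word_perm (rcons w k)) k.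
Proof.
move=> red; rewrite /descent word_perm_rcons !permM transpL transpR.
rewrite ltnNge leq_eqVlt negb_or; apply/andP; split.
  by rewrite val_eqE (inj_eq perm_inj) eq_sym pos_neq.
apply/negP => desc; have [w' sw pw] := exchange desc.
by have := red w' pw; rewrite size_rcons sw ltnNge leqnSn.
Qed.

Lemma reduced_size w w' : reduced w -> word_perm w' = word_perm w ->
  (size w' <= size w)%N -> reduced w'.
Proof. by move=> red E sz w'' E'; apply: leq_trans sz (red _ _); rewrite E' E. Qed.

Definition avoids321 d : Prop := forall x y z : 'I_n,
  (x < y < z)%N -> ~~ (d z < d y < d x)%N.

(** A descent reverses only the pair k, k + 1, which is increasing after the
    exchange; a decreasing triple of the new permutation is thus one of the old. *)
Lemma avoids321_descent d k : avoids321 d -> descent d k ->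
  avoids321 (transp k * d)%g.
Proof.
move=> av desc x y z /andP [xy yz]; rewrite !permM; apply/negP => /andP [h1 h2].
have sorted_transp (a b : 'I_n) : (a < b)%N -> (d (transp k b) < d (transp k a))%N ->
    (transp k a < transp k b)%N.
  move=> ab; move: desc; rewrite /descent /transp.
  case: (tpermP (pos k) _ a) => [aE|aE|/eqP a1 /eqP a2];
  case: (tpermP (pos k) _ b) => [bE|bE|/eqP b1 /eqP b2];
  move: ab; rewrite ?aE ?bE /=; try lia.
  - by move: b1 b2; rewrite -!val_eqE /=; lia.
  - by move: a1 a2; rewrite -!val_eqE /=; lia.
have := av _ _ _ (introT andP (conj (sorted_transp _ _ xy h2) (sorted_transp _ _ yz h1))).
by rewrite h1 h2.
Qed.

Section Product.
Variables (S : pzRingType) (f : 'I_n.-1 -> S).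
Hypothesis f_comm : forall k l, k.+1 != l :> nat -> l.+1 != k :> nat ->
  f k * f l = f l * f k.

(** Let the words end in k and l.  If k = l, drop this letter.  Otherwise both are
    descents, and avoiding 321 makes them distant; the exchange property yields a common
    remainder a' such that a' l and a' k represent the two prefixes, and the
    last two letters commute. *)
Lemma reduced_prod_eq w w' : reduced w -> reduced w' ->
  word_perm w = word_perm w' -> avoids321 (word_perm w) ->
  \prod_(k <- w) f k = \prod_(k <- w') f k.
Proof.
have [t] := ubnP (size w); elim: t w w' => // t IH w w' + red red' E av.
have sz : size w = size w' by apply/eqP; rewrite eqn_leq red // red'.
case/lastP: w red E av sz => [|a k] red E av sz.
  by move: sz => /esym/size0nil ->.
case/lastP: w' red' E sz => [|b l] red' E sz; first by rewrite size_rcons in sz.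
rewrite size_rcons ltnS => a_t; move: sz; rewrite !size_rcons => -[] sz.
have dk := reduced_descent red; have dl := reduced_descent red'.
rewrite -E in dl; have ra := reduced_prefix red; have rb := reduced_prefix red'.
have ava : avoids321 (word_perm a).
  have := avoids321_descent av dk.
  by rewrite word_perm_rcons mulgA transp_sq mul1g.
have prod_rcons (c : seq 'I_n.-1) m : \prod_(i <- rcons c m) f i = (\prod_(i <- c) f i) * f m.
  by rewrite -cats1 big_cat big_seq1.
rewrite !prod_rcons; have [kl|nkl] := eqVneq k l.
  rewrite -kl; congr (_ * _); apply: IH => //.
  by apply: (mulgI (transp k)); rewrite -word_perm_rcons E kl word_perm_rcons.
have far (i i' : 'I_n.-1) : descent (word_perm (rcons a k)) i ->
    descent (word_perm (rcons a k)) i' -> i.+1 != i' :> nat.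
  move=> di di'; apply/negP => /eqP ii'.
  have pE : pos' i = pos i' by apply: val_inj.
  have := av (pos i) (pos' i) (pos' i'); rewrite /= ii' !ltnSn -ii' ltnSn => /(_ isT).
  by move: di di'; rewrite /descent -pE => -> ->.
have kl := far _ _ dk dl; have lk := far _ _ dl dk.
have nkl' : k != l :> nat by [].
have da : descent (word_perm a) l.
  move: dl; rewrite /descent word_perm_rcons !permM !transpD // -val_eqE /=; lia.
have [a' sa pa] := exchange da.
have pa' : word_perm (rcons a' l) = word_perm a.
  by rewrite word_perm_rcons pa word_perm_rcons mulgA transp_sq mul1g.
have raa : reduced (rcons a' l) by apply: reduced_size ra pa' _; rewrite size_rcons sa.
have pb : word_perm (rcons a' k) = word_perm b.
  apply: (mulgI (transp l)); rewrite -[RHS]word_perm_rcons -E !word_perm_rcons pa.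
  by rewrite word_perm_rcons !mulgA (transp_comm lk kl) -(mulgA (transp k)) transp_sq mulg1.
have rak : reduced (rcons a' k) by apply: reduced_size rb pb _; rewrite size_rcons -sa sz.
have avb : avoids321 (word_perm (rcons a' k)).
  rewrite pb; have := avoids321_descent av dl.
  by rewrite E word_perm_rcons mulgA transp_sq mul1g.
rewrite (IH a (rcons a' l)) // -(IH (rcons a' k) b) //; last by rewrite size_rcons -sa.
by rewrite !prod_rcons -!mulrA f_comm.
Qed.
End Product.

(** The anti-involution is handled in the converse ring, where the reversed word
    becomes the word itself. *)
Lemma prod_rev_converse (S : pzRingType) (f : 'I_n.-1 -> S) w :
  \prod_(k <- rev w) f k = (\prod_(k <- w) (f k : S^c)) :> S.
Proof.
elim: w => [|k w IH]; first by rewrite !big_nil.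
by rewrite rev_cons -cats1 big_cat big_seq1 big_cons IH.
Qed.

Lemma reduced_prod_rev_eq (S : pzRingType) (f : 'I_n.-1 -> S) w w' :
  (forall k l, k.+1 != l :> nat -> l.+1 != k :> nat -> f k * f l = f l * f k) ->
  reduced w -> reduced w' -> word_perm w = word_perm w' -> avoids321 (word_perm w) ->
  \prod_(k <- rev w) f k = \prod_(k <- rev w') f k.
Proof.
move=> f_comm red red' E av; rewrite !prod_rev_converse.
apply: (reduced_prod_eq (S := S^c)) red red' E av => k l kl lk.
exact/esym/f_comm.
Qed.
End Words.

(** * Dimension of the simple quotient *)

Section Dimensions.

Lemma dim_quot_space (K : fieldType) (V : vectType K) (U : {vspace V}) :
  \dim {: quot_space U} = (\dim {: V} - \dim U)%N.
Proof. by rewrite dimvf -dimv_compl. Qed.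

Variables (R : fieldType) (e n r r' : nat).
Variables (j : 'I_r -> residue e) (j' : 'I_r' -> residue e).
Variables (w : word_family r n) (w' : word_family r' n).
Variables (lam : ocpart r n) (lam' : ocpart r' n).
Variables (W : cell_module R j w lam) (W' : cell_module R j' w' lam').
Variables (beta : Std lam -> Std lam') (betai : Std lam' -> Std lam).
Hypothesis betaK : cancel beta betai.
Hypothesis betaiK : cancel betai beta.
Hypothesis gramE : forall t s, cell_gram W t s = cell_gram W' (beta t) (beta s).

Definition relabel (x : cell_space R lam) : cell_space R lam' :=
  [ffun s => x (betai s)].

Lemma relabel_linear : linear relabel.
Proof. by move=> c x y; apply/ffunP => s; rewrite !ffunE. Qed.
HB.instance Definition _ :=
  GRing.isLinear.Build R (cell_space R lam) (cell_space R lam') _ relabel relabel_linear.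

Lemma relabel_inj : injective relabel.
Proof.
move=> x y /ffunP E; apply/ffunP => s.
by have := E (beta s); rewrite !ffunE betaK.
Qed.

Lemma to_dual_relabel x : to_dual W' (relabel x) = relabel (to_dual W x).
Proof.
apply/ffunP => s; rewrite !ffunE (reindex beta) /=; last first.
  by exists betai => t _; [exact: betaK|exact: betaiK].
by apply: eq_bigr => t _; rewrite ffunE betaK gramE betaiK.
Qed.

Lemma relabel_lker : lker (linfun relabel) == 0%VS.
Proof. by apply/lker0P => x y; rewrite !lfunE; exact: relabel_inj. Qed.

Lemma dim_cell_rad : \dim (cell_rad W) = \dim (cell_rad W').
Proof.
rewrite -(limg_dim_eq (f := linfun relabel)); last first.
  by rewrite (eqP relabel_lker) capv0.
congr (\dim _); apply/vspaceP => y; apply/idP/idP.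
  move/memv_imgP => [x xW ->]; move: xW; rewrite !memv_ker !lfunE /=.
  by rewrite to_dual_relabel => /eqP ->; rewrite linear0.
move=> yW; pose x : cell_space R lam := [ffun s => y (beta s)].
have yE : y = linfun relabel x.
  by rewrite lfunE; apply/ffunP => s; rewrite !ffunE betaiK.
rewrite yE; apply: memv_img; move: yW; rewrite yE !memv_ker !lfunE /=.
by rewrite to_dual_relabel -[X in _ == X](linear0 relabel) (inj_eq relabel_inj).
Qed.

Lemma dim_simple_module : \dim {: simple_module W} = \dim {: simple_module W'}.
Proof.
rewrite [LHS]dim_quot_space [RHS]dim_quot_space dim_cell_rad; congr (_ - _)%N.
rewrite -(limg_dim_eq (f := linfun relabel) (U := fullv)); last first.
  by rewrite (eqP relabel_lker) capv0.
congr (\dim _); apply/vspaceP => y; rewrite memvf; apply/memv_imgP.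
exists [ffun s => y (beta s)]; first exact: memvf.
by rewrite lfunE; apply/ffunP => s; rewrite !ffunE betaiK.
Qed.
End Dimensions.

(** * Standard tableaux and their words *)

Section StdTransport.
Variables (r r' n : nat) (lam : ocpart r n) (lam' : ocpart r' n).
Variable phi : node r n -> node r' n.
Hypothesis phi_row : forall g, (phi g).1 = g.1.
Hypothesis phi_inj : {in nodes lam &, injective phi}.
Hypothesis phi_onto : phi @: nodes lam = nodes lam'.
Hypothesis phi_col : {in nodes lam &, forall g h, (phi g).2 = (phi h).2 -> g.2 = h.2}.

Lemma std_mem (t : {ffun 'I_n -> node r n}) k : is_std lam t -> t k \in nodes lam.
Proof. by move=> /and3P [_ /eqP <- _]; apply: imset_f; rewrite inE. Qed.

Lemma std_transport t : is_std lam t -> is_std lam' [ffun k => phi (t k)].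
Proof.
move=> tS; have tm k : t k \in nodes lam by exact: std_mem.
case/and3P: tS => /injectiveP t_inj /eqP t_onto /forallP t_std; apply/and3P; split.
- apply/injectiveP => k l; rewrite !ffunE => E; apply: t_inj; exact: phi_inj.
- rewrite -phi_onto -t_onto -imset_comp; apply/eqP/eq_imset => k.
  by rewrite ffunE.
- apply/forallP => k; apply/forallP => l; rewrite !ffunE !phi_row.
  apply/implyP => /andP [/eqP c rkl].
  have /forallP /(_ l) /implyP := t_std k; apply.
  by rewrite rkl andbT; apply/eqP; exact: phi_col.
Qed.
End StdTransport.

Section Tableaux.
Variables (r n : nat) (lam : ocpart r n).

Lemma tab_init_std : is_std lam (tab_init lam).
Proof.
apply/and3P; split.
- apply/injectiveP; exact: tab_init_inj.
- apply/eqP/setP => g; apply/imsetP/idP => [[k _ ->]|/tab_init_surj [k <-]].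
    exact: tab_init_mem.
  by exists k.
- apply/forallP => k; apply/forallP => l; apply/implyP => /andP [/eqP c].
  by rewrite (tab_init_ltE c).
Qed.

Definition std_init : Std lam := exist _ (tab_init lam) tab_init_std.

Variable w : word_family r n.
Hypothesis hw : official w.

Lemma word_perm_spec (t : Std lam) k : val t k = tab_init lam (word_perm (w t) k).
Proof. by case: (hw t) => + _ _; apply. Qed.

Lemma word_reduced (t : Std lam) : reduced (w t).
Proof. by case: (hw t). Qed.

Lemma word_perm_unique (t : Std lam) (d : 'S_n) :
  d_spec t d -> word_perm (w t) = d.
Proof.
move=> dt; apply/permP => k; apply: (@tab_init_inj _ _ lam).
by rewrite -word_perm_spec dt.
Qed.

Lemma word_init : w std_init = [::].
Proof.
have E : word_perm (w std_init) = 1%g.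
  by apply: word_perm_unique => k; rewrite perm1.
by apply/nilP; rewrite /nilp -leqn0; apply: (word_reduced (t := std_init) (w' := [::]));
  rewrite E word_perm_nil.
Qed.

(** Of three positions two share a column, and within a column a standard tableau
    is increasing. *)
Lemma two_column_avoids321 (c1 c2 : 'I_r) (t : Std lam) :
  (forall k, ((tab_init lam k).2 == c1) || ((tab_init lam k).2 == c2)) ->
  avoids321 (word_perm (w t)).
Proof.
move=> cols x y z /andP [xy yz]; apply/negP => /andP [dzy dyx].
have same (a b : 'I_n) : (a < b)%N -> (word_perm (w t) b < word_perm (w t) a)%N ->
    (val t a).2 <> (val t b).2.
  move=> ab dba E; have E' := E; rewrite !word_perm_spec in E'.
  move: dba; rewrite (tab_init_ltE (esym E')) -!word_perm_spec => rba.
  have /and3P [_ _ /forallP /(_ b) /forallP /(_ a) /implyP] := valP t.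
  by rewrite E eqxx rba => /(_ isT); rewrite ltnNge (ltnW ab).
have := same _ _ xy dyx; have := same _ _ yz dzy.
have := same _ _ (ltn_trans xy yz) (ltn_trans dzy dyx).
rewrite !word_perm_spec; move: (cols (word_perm (w t) x)) (cols (word_perm (w t) y))
  (cols (word_perm (w t) z)).
by case/orP => /eqP ->; case/orP => /eqP ->; case/orP => /eqP ->.
Qed.
End Tableaux.

(** * The Gram matrix in the reduced module *)

Definition idem_at (R : fieldType) (e n : nat) (i : res_seq n e) :
  klr_free R (orbit_of i) := fe R [` orbit_of_refl i]%fset.

Section GramRelation.
Variables (R : fieldType) (e n : nat) (K : fieldType) (iota : {rmorphism {poly R} -> K}).
Hypothesis z_neq0 : iota 'X != 0.

Section OneSide.
Variables (r : nat) (j : 'I_r -> residue e).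
Hypothesis hj : forall a b : 'I_r, a != b -> (2 < res_dist (j a) (j b))%N.
Variables (u v : 'I_r) (lam : ocpart r n).
Hypothesis uv : (u < v)%N.
Hypothesis hcomp : forall l : 'I_r, (0 < comp_size lam l)%N = (l == u) || (l == v).
Variables (w : word_family r n) (hw : official w) (W : cell_module R j w lam).

Local Notation J := (col_charge j u v).
Local Notation i0 := (tab_res j lam).
Local Notation m := (comp_size lam u).
Let uvn := uv_neq uv.

Lemma lower_span_ann (x : TL R n (weight_of j)) : lower_span w lam x -> ann_TL iota u v m i0 x.
Proof.
have [a0 aD aMl aMr] := ann_TL_two_sided hj z_neq0 m i0 uvn.
elim=> [|c mu s t y _ smu _ IH]; first exact: a0.
apply: aD IH; apply: (aMl).
rewrite /cellC; apply: aMr; apply: aMl.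
apply: (ann_TL_e hj z_neq0) => // p; exact: (lower_res_avoid hj uv hcomp smu).
Qed.

(** The congruence that defines the form, at the outer tableaux t^lambda. *)
Lemma gram_annih_tab (s t : Std lam) :
  annih J iota m
    (idem_at R i0 * \prod_(k <- w t) fpsi R _ k *
      (\prod_(k <- rev (w s)) fpsi R _ k * idem_at R i0)
     - Defs.scalar (cell_gram W t s) * idem_at R i0).
Proof.
have low := cell_gramP W (std_init lam) t s (std_init lam).
move/lower_span_ann: low; apply: (lifts_annih hj z_neq0) => //.
rewrite /cellC !word_init //.
have l1 : lifts (i0 := i0) (psi_word R j (rev [::] : seq 'I_n.-1)) 1.
  by rewrite /psi_word big_nil; exact: lifts_one.
have l1' : lifts (i0 := i0) (psi_word R j ([::] : seq 'I_n.-1)) 1.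
  by rewrite /psi_word big_nil; exact: lifts_one.
have le : lifts (i0 := i0) (tl_e R (weight_of j) i0) (idem_at R i0).
  by have := lifts_e R j [` orbit_of_refl i0]%fset.
set E := idem_at R i0 in le *.
set P := \prod_(k <- w t) _; set Q := \prod_(k <- rev _) _.
have lPs : lifts (psi_word R j (rev [::] : seq 'I_n.-1) * tl_e R (weight_of j) i0) E.
  by have := lifts_mul l1 le; rewrite mul1r.
have lQE : lifts (psi_word R j (rev (w s)) * tl_e R (weight_of j) i0
    * psi_word R j ([::] : seq 'I_n.-1)) (Q * E).
  by have := lifts_mul (lifts_mul (lifts_word R j i0 (rev (w s))) le) l1'; rewrite mulr1.
have lE1 : lifts (psi_word R j (rev [::] : seq 'I_n.-1) * tl_e R (weight_of j) i0
    * psi_word R j ([::] : seq 'I_n.-1)) E.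
  by have := lifts_mul lPs l1'; rewrite mulr1.
apply: lifts_add; last by apply: lifts_opp; apply: lifts_mul lE1; exact: lifts_scalar.
by apply: lifts_mul lQE; apply: lifts_mul lPs _; exact: lifts_word.
Qed.

(** The block occurs in the type of the elements, and the charges and the column
    length in the lattice; equations between them let the relations of two different
    algebras meet in one module. *)
Lemma gram_annih J' i m' (s t : Std lam) : J' = J -> i = i0 -> m' = m ->
  annih J' iota m'
    (idem_at R i * \prod_(k <- w t) fpsi R _ k *
      (\prod_(k <- rev (w s)) fpsi R _ k * idem_at R i)
     - Defs.scalar (cell_gram W t s) * idem_at R i).
Proof. by move=> -> -> ->; exact: gram_annih_tab. Qed.

Hypothesis iota_inj : injective iota.

Lemma idem_not_annih : ~ annih J iota m (idem_at R i0).
Proof.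
move=> /(_ _ (lattice_base J (orbit_of i0) iota m i0)) [h Lh].
move/ffunP/(_ (tab_walk u lam)); rewrite act_e mask_fun_pt !ffunE /=.
rewrite tab_walk_region // tab_walk_res // eqxx mulr1.
have [c ->] := lattice_int (tab_walk u lam) Lh.
rewrite /GRing.scale /= -(rmorph1 iota) -rmorphM => /iota_inj /(congr1 (fun q => q.[0])).
by rewrite hornerM hornerX mul0r hornerC => /eqP; rewrite oner_eq0.
Qed.
End OneSide.
End GramRelation.

Section WordAction.
Variables (R : fieldType) (e n : nat) (J : bool -> residue e).
Variables (O : {fset res_seq n e}) (K : fieldType) (iota : {rmorphism {poly R} -> K}).

Hypothesis z_neq0 : iota 'X != 0.

Local Notation rep := (@rep R e n J O K iota).

Lemma rep_word (s : seq 'I_n.-1) :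
  rep (\prod_(k <- s) fpsi R O k) = \prod_(k <- s) rep (fpsi R O k).
Proof.
apply: big_morph; last exact: free_lift1.
by move=> a b; exact: (@free_liftM _ _ _ _ _ (@const_end_comm _ _ _ _)).
Qed.

Lemma rep_psi_comm (k l : 'I_n.-1) : k.+1 != l :> nat -> l.+1 != k :> nat ->
  rep (fpsi R O k) * rep (fpsi R O l) = rep (fpsi R O l) * rep (fpsi R O k).
Proof.
move=> kl lk; apply: act_inj => g; rewrite [LHS]actM [RHS]actM.
have E a b : act_fun (rep (fpsi R O a)) (act_fun (rep (fpsi R O b)) g) =
    psi_fun J iota a (psi_fun J iota b g).
  exact: etrans (act_psi J O iota a _) (congr1 _ (act_psi J O iota b g)).
apply: etrans (E k l) _; apply: esym; apply: etrans (E l k) _.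
by apply/ffunP => p; rewrite !psi_fun_psi; exact: psi_comm.
Qed.

Lemma act_word_eq (a b : seq 'I_n.-1) g : reduced a -> reduced b ->
  word_perm a = word_perm b -> avoids321 (word_perm a) ->
  act J iota (\prod_(k <- a) fpsi R O k) g = act J iota (\prod_(k <- b) fpsi R O k) g.
Proof.
move=> ra rb E av; rewrite /act !rep_word; congr (act_fun _ g).
by apply: reduced_prod_eq ra rb E av => k l; exact: rep_psi_comm.
Qed.

Lemma act_rev_word_eq (a b : seq 'I_n.-1) g : reduced a -> reduced b ->
  word_perm a = word_perm b -> avoids321 (word_perm a) ->
  act J iota (\prod_(k <- rev a) fpsi R O k) g =
  act J iota (\prod_(k <- rev b) fpsi R O k) g.
Proof.
move=> ra rb E av; rewrite /act !rep_word; congr (act_fun _ g).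
by apply: reduced_prod_rev_eq ra rb E av => k l; exact: rep_psi_comm.
Qed.
End WordAction.

(** * Restriction to the two non-empty columns *)

Section TwoColumns.
Variables (r n : nat) (lam : ocpart r n) (lam' : ocpart 2 n) (u v : 'I_r).
Hypothesis uv : (u < v)%N.
Hypothesis hcomp : forall l : 'I_r, (0 < comp_size lam l)%N = (l == u) || (l == v).
Hypothesis hlam'1 : comp_size lam' ord0 = comp_size lam u.
Hypothesis hlam'2 : comp_size lam' ord_max = comp_size lam v.

Definition to_two (g : node r n) : node 2 n :=
  (g.1, if g.2 == u then ord0 else ord_max).
Definition of_two (g : node 2 n) : node r n :=
  (g.1, if g.2 == ord0 then u else v).

Lemma ord2_cases (c : 'I_2) : c = ord0 \/ c = ord_max.
Proof. by case: c => [[|[|//]] h]; [left|right]; apply: val_inj. Qed.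

Lemma node_col g : g \in nodes lam -> g.2 = u \/ g.2 = v.
Proof.
rewrite nodes_row => /andP [g1 g2]; have := hcomp g.2; rewrite (leq_trans g1 g2).
by move=> /esym/orP [] /eqP; auto.
Qed.

Lemma to_twoK g : g \in nodes lam -> of_two (to_two g) = g.
Proof.
move=> /node_col; case: g => a c [] /= ->; rewrite /of_two /to_two /= ?eqxx //.
by rewrite (_ : v == u = false) // -val_eqE /=; lia.
Qed.

Lemma of_twoK g : to_two (of_two g) = g.
Proof.
case: g => a c; have vu : v == u = false by rewrite -val_eqE /=; lia.
by case: (ord2_cases c) => ->; rewrite /of_two /to_two /= ?eqxx ?vu.
Qed.

Lemma of_two_nodes g : (of_two g \in nodes lam) = (g \in nodes lam').
Proof.
rewrite !nodes_row; case: g => a c.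
by case: (ord2_cases c) => ->; rewrite /of_two /= ?hlam'1 ?hlam'2.
Qed.

Lemma to_two_nodes g : g \in nodes lam -> to_two g \in nodes lam'.
Proof. by move=> h; rewrite -of_two_nodes to_twoK. Qed.

Lemma to_two_onto : to_two @: nodes lam = nodes lam'.
Proof.
apply/setP => g; apply/imsetP/idP => [[h hl ->]|gl]; first exact: to_two_nodes.
by exists (of_two g); rewrite ?of_two_nodes ?of_twoK.
Qed.

Lemma of_two_onto : of_two @: nodes lam' = nodes lam.
Proof.
apply/setP => g; apply/imsetP/idP => [[h hl ->]|gl]; first by rewrite of_two_nodes.
by exists (to_two g); rewrite ?to_two_nodes ?to_twoK.
Qed.

Lemma to_two_std t : is_std lam t -> is_std lam' [ffun k => to_two (t k)].
Proof.
apply: std_transport => //; last 2 first.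
- exact: to_two_onto.
- move=> g h /node_col gc /node_col hc /=; move: gc hc.
  have vu : v == u = false by rewrite -val_eqE /=; lia.
  by case=> ->; case=> ->; rewrite ?eqxx ?vu.
- by move=> g h gl hl E; rewrite -(to_twoK gl) E to_twoK.
Qed.

Lemma of_two_std t : is_std lam' t -> is_std lam [ffun k => of_two (t k)].
Proof.
apply: std_transport => //; last 2 first.
- exact: of_two_onto.
- move=> [a c] [b d] _ _ /=.
  by case: (ord2_cases c) => ->; case: (ord2_cases d) => -> //= /eqP;
    rewrite -val_eqE /=; lia.
- by move=> g h _ _ E; rewrite -(of_twoK g) E of_twoK.
Qed.

Definition std_to_two (t : Std lam) : Std lam' :=
  exist (fun f => is_std lam' f) _ (to_two_std (valP t)).
Definition std_of_two (t : Std lam') : Std lam :=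
  exist (fun f => is_std lam f) _ (of_two_std (valP t)).

Lemma std_to_twoK : cancel std_to_two std_of_two.
Proof.
move=> t; apply: val_inj; apply/ffunP => k /=; rewrite !ffunE to_twoK //.
exact: std_mem (valP t).
Qed.

Lemma std_of_twoK : cancel std_of_two std_to_two.
Proof. by move=> t; apply: val_inj; apply/ffunP => k /=; rewrite !ffunE of_twoK. Qed.

Lemma tab_init_two k : tab_init lam' k = to_two (tab_init lam k).
Proof.
have g0 := tab_init lam k.
rewrite (tab_initE lam' (to_two g0)) (tab_initE lam g0) -(nth_map g0 (to_two g0)); last first.
  by rewrite size_nodes.
congr (nth _ _ _); apply: (sorted_eq (@node_le_trans 2 n) (@node_le_anti 2 n)).
- exact: (sort_sorted (@node_le_total 2 n)).
- rewrite sorted_map; apply: (sub_in_sorted (P := mem (nodes lam)) _ _ (sort_sorted (@node_le_total r n) _)).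
    move=> g h /node_col + /node_col; case: g => a c; case: h => b d /=.
    have vu : v == u = false by rewrite -val_eqE /=; lia.
    by case=> ->; case=> ->; rewrite /node_le /= ?eqxx ?vu /=; lia.
  by apply/allP => g; rewrite mem_node_seq.
- apply: uniq_perm; first exact: node_seq_uniq.
    rewrite map_inj_in_uniq ?node_seq_uniq // => g h; rewrite !mem_node_seq => gl hl E.
    by rewrite -(to_twoK gl) E to_twoK.
  move=> g; rewrite mem_node_seq; apply/idP/mapP => [gl|[h hl ->]].
    by exists (of_two g); rewrite ?of_twoK // mem_node_seq of_two_nodes.
  by apply: to_two_nodes; rewrite -mem_node_seq.
Qed.
End TwoColumns.

(** * Comparison of the two algebras *)

Section Compare.
Variables (R : fieldType) (e n : nat) (J : bool -> residue e).
Variables (O : {fset res_seq n e}) (K : fieldType) (iota : {rmorphism {poly R} -> K}).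
Variable m : nat.
Implicit Types (E X P Q : klr_free R O).

Local Notation act := (@act R e n J O K iota).
Local Notation annih := (@annih R e n J O K iota m).

Lemma act_sandwich E P P' Q Q' g : (forall h, act P h = act P' h) ->
  (forall h, act Q h = act Q' h) -> act (E * P * (Q * E)) g = act (E * P' * (Q' * E)) g.
Proof.
move=> HP HQ; have hQ : act (Q * E) g = act (Q' * E) g.
  by rewrite [LHS]act_mul [RHS]act_mul HQ.
rewrite [LHS]act_mul [RHS]act_mul [LHS]act_mul [RHS]act_mul -HP.
exact: (congr1 (fun h => act E (act P h)) hQ).
Qed.

Lemma annih_scalar_eq E X X' c c' : (forall g, act X g = act X' g) ->
  annih (X - Defs.scalar c * E) -> annih (X' - Defs.scalar c' * E) ->
  ~ annih E -> c = c'.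
Proof.
move=> XX' hX hX' nE; apply/eqP/negPn/negP => cc'; apply: nE => g Lg.
have actS d : act (Defs.scalar d * E) g = iota d%:P *: act E g.
  by rewrite act_mul act_scalar.
have h := hX g Lg; rewrite act_sub actS XX' in h.
have h' := hX' g Lg; rewrite act_sub actS in h'.
have D := smallD h' (smallZ (-1) h).
rewrite rmorphN rmorph1 scaleN1r opprB addrC addrA subrK in D.
have := smallZ (c - c')^-1%:P D.
rewrite -scalerBl -rmorphB -polyCB scalerA -rmorphM -polyCM mulVf ?subr_eq0 //.
by rewrite rmorph1 scale1r.
Qed.
End Compare.

Section Comparison.
Variables (R : fieldType) (e r n : nat) (j : 'I_r -> residue e).
Hypothesis hj : forall a b : 'I_r, a != b -> (2 < res_dist (j a) (j b))%N.
Variables (u v : 'I_r) (lam : ocpart r n) (lam' : ocpart 2 n).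
Hypothesis uv : (u < v)%N.
Hypothesis hcomp : forall l : 'I_r, (0 < comp_size lam l)%N = (l == u) || (l == v).
Hypothesis hlam'1 : comp_size lam' ord0 = comp_size lam u.
Hypothesis hlam'2 : comp_size lam' ord_max = comp_size lam v.

Local Notation j' := (two_fun (j u) (j v)).

Lemma two_fun_sep (a b : 'I_2) : a != b -> (2 < res_dist (j' a) (j' b))%N.
Proof.
have uvn := uv_neq uv.
by case: (ord2_cases a) => ->; case: (ord2_cases b) => -> // _; apply: hj => //;
  rewrite eq_sym.
Qed.

Lemma two_fun_comp (l : 'I_2) :
  (0 < comp_size lam' l)%N = (l == ord0) || (l == ord_max).
Proof.
case: (ord2_cases l) => ->; rewrite ?hlam'1 ?hlam'2 hcomp ?eqxx ?orbT //.
Qed.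

Lemma col_charge_two_fun : col_charge j' ord0 ord_max = col_charge j u v.
Proof. by apply: functional_extensionality_dep; case. Qed.

Lemma tab_res_two_fun : tab_res j' lam' = tab_res j lam.
Proof.
apply/ffunP => k; rewrite [LHS]ffunE [RHS]ffunE.
rewrite (tab_init_two uv hcomp hlam'1 hlam'2) /node_res /to_two /=.
have vu : v == u = false by rewrite -val_eqE /=; lia.
by case: (node_col hcomp (tab_init_mem lam k)) => ->; rewrite ?eqxx ?vu.
Qed.

Variables (w : word_family r n) (w' : word_family 2 n).
Hypotheses (hw : official w) (hw' : official w').
Variables (W : cell_module R j w lam) (W' : cell_module R j' w' lam').

Local Notation beta := (std_to_two uv hcomp hlam'1 hlam'2).

Lemma word_perm_two (t : Std lam) : word_perm (w t) = word_perm (w' (beta t)).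
Proof.
apply/esym/word_perm_unique => // k /=.
by rewrite ffunE (word_perm_spec hw) (tab_init_two uv hcomp hlam'1 hlam'2).
Qed.

Lemma words_avoid321 (t : Std lam) : avoids321 (word_perm (w t)).
Proof.
apply: (two_column_avoids321 hw (c1 := u) (c2 := v)) => k.
by case: (node_col hcomp (tab_init_mem lam k)) => ->; rewrite eqxx ?orbT.
Qed.

(** Both entries satisfy the same relation in the reduced module, where e_lambda
    is nonzero. *)
Lemma cell_gram_two (K : fieldType) (iota : {rmorphism {poly R} -> K}) :
  injective iota -> forall t s, cell_gram W t s = cell_gram W' (beta t) (beta s).
Proof.
move=> iota_inj t s.
have z_neq0 : iota 'X != 0 by rewrite -(rmorph0 iota) (inj_eq iota_inj) polyX_eq0.
have uv2 : ((ord0 : 'I_2) < (ord_max : 'I_2))%N by [].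
have A := gram_annih_tab z_neq0 hj uv hcomp hw W s t.
have A' := gram_annih z_neq0 two_fun_sep uv2 two_fun_comp hw' W' (beta s) (beta t)
  (esym col_charge_two_fun) (esym tab_res_two_fun) (esym hlam'1).
apply: annih_scalar_eq A A' (idem_not_annih uv hcomp iota_inj (j := j)) => g.
apply: act_sandwich => h.
  apply: act_word_eq => //; [exact: word_reduced|exact: word_reduced| |].
    exact: word_perm_two.
  exact: words_avoid321.
apply: act_rev_word_eq => //; [exact: word_reduced|exact: word_reduced| |].
  exact: word_perm_two.
exact: words_avoid321.
Qed.
End Comparison.

Theorem corollary6p12
  (R : fieldType) (charR : [pchar R] =i pred0)
  (q : R) (q_neq0 : q != 0) (q_neq1 : q != 1)
  (e : nat) (he : quantum_char q e)
  (r n : nat) (hr : (2 <= r)%N) (hn : (3 <= n)%N)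
  (j : 'I_r -> residue e)
  (hj : forall a b : 'I_r, a != b -> (2 < res_dist (j a) (j b))%N)
  (w : word_family r n) (hw : official w)
  (w' : word_family 2 n) (hw' : official w')
  (lam : ocpart r n) (hlam : notD lam)
  (u v : 'I_r) (huv : (u < v)%N)
  (hcomp : forall l : 'I_r, (0 < comp_size lam l)%N = (l == u) || (l == v))
  (lam' : ocpart 2 n)
  (hlam'1 : comp_size lam' ord0 = comp_size lam u)
  (hlam'2 : comp_size lam' ord_max = comp_size lam v)
  (W : cell_module R j w lam)
  (W' : cell_module R (two_fun (j u) (j v)) w' lam') :
  \dim {: simple_module W} = \dim {: simple_module W'}.
Proof.
apply: (dim_simple_module (std_to_twoK huv hcomp hlam'1 hlam'2)
                          (std_of_twoK huv hcomp hlam'1 hlam'2)).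
apply: (cell_gram_two hj huv hcomp hlam'1 hlam'2 hw hw' W W' (iota := @tofrac {poly R})).
by move=> f g /eqP; rewrite tofrac_eq => /eqP.
Qed.
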